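(* Suppose that Assumption A (stated in the context) holds. Then the performative loss $\mathcal L$ is $L_{\mathcal L}^{\mathrm{sm}}$-smooth: for any $\theta,\theta'\in\Theta$, $$\|\nabla\mathcal L(\theta)-\nabla\mathcal L(\theta')\|\le L_{\mathcal L}^{\mathrm{sm}}\|\theta-\theta'\|,$$ where $$L_{\mathcal L}^{\mathrm{sm}} := L_{\ell,\theta}^{\mathrm{sm}} + L_{\ell,\theta}^{\mathrm{Lip}} L_{\beta,\theta}^{\mathrm{Lip}}\sqrt{I_{\max}} + L_{\beta,\theta}^{\mathrm{sm}}\sqrt{M_\ell I_{\max}} + L_{\beta,\theta}^{\mathrm{Lip}}\left(L_{G,\beta}^{\mathrm{Lip}} L_{\beta,\theta}^{\mathrm{Lip}} + L_{G,\theta}^{\mathrm{Lip}}\right)$$ with the constants defined in the context.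
   Context: Setting. $n,m,d$ are positive integers; $\|\cdot\|$ is the Euclidean norm for vectors and the induced (operator) norm for matrices and for derivative tensors. $\Theta\subseteq\mathbb R^n$ is the model parameter set, $\beta:\mathbb R^n\to\mathbb R^m$ the distribution parameter mapping with $m\times n$ Jacobian $\frac{\partial\beta}{\partial\theta}$, $B\subseteq\mathbb R^m$ the distribution parameter space, and $\ell:\mathbb R^d\times\mathbb R^n\to\mathbb R$, $(z,\theta)\mapsto\ell(z;\theta)$, the loss. $\{\mathcal D_{\beta_0}\}_{\beta_0\in B}$ is a family of probability distributions on a data space $\mathcal Z\subseteq\mathbb R^d$, dominated by a common $\sigma$-finite measure $\mu$, with densities $p(\cdot;\beta_0)$. $\mathrm{Pred}$ is an estimator mapping a finite dataset to an element of $B$. For a perturbation radius $\delta>0$, with $e_i$ the standard basis vectors of $\mathbb R^n$, $$\Theta_\delta:=\{\theta\in\Theta:\theta\pm\delta e_i\in\Theta,\ i=1,\dots,n\}.$$ Define the score $s(z;\beta_0):=\nabla_\beta\ln p(z;\beta_0)$, $G(\theta;\beta_0):=\mathbb E_{z\sim\mathcal D_{\beta_0}}[\ell(z;\theta)s(z;\beta_0)]\in\mathbb R^m$, the Fisher information $I(\beta_0):=\mathbb E_{z\sim\mathcal D_{\beta_0}}[s(z;\beta_0)s(z;\beta_0)^\top]$, and the performative loss $\mathcal L(\theta):=\mathbb E_{z\sim\mathcal D_{\beta(\theta)}}[\ell(z;\theta)]$. Its gradient is $\nabla\mathcal L(\theta)=\nabla_1\mathcal L(\theta)+\nabla_2\mathcal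 L(\theta)$ with $\nabla_1\mathcal L(\theta)=\mathbb E_{z\sim\mathcal D_{\beta(\theta)}}[\nabla_\theta\ell(z;\theta)]$ and $\nabla_2\mathcal L(\theta)=\frac{\partial\beta}{\partial\theta}(\theta)^\top G(\theta;\beta(\theta))$. Assumption A. (1) $\Theta$ and $\Theta_\delta$ are nonempty, closed, convex and compact. (2) $B$ is convex and compact, and $\beta(\Theta)\subseteq B$. (3) $\beta$ is $C^3$. (4) The densities $\{p(\cdot;\beta_0)\}_{\beta_0\in B}$ have common support, $p(z;\cdot)$ is $C^2$ on $B$, and differentiation under the integral sign with respect to $\beta_0$ is valid (for the integrals $\int p\,d\mu$, $\int\ell\,p\,d\mu$, $\int\ell\,s\,p\,d\mu$). (5) There are finite constants $K_1,K_2\ge0$ and integers $q_1,q_2\ge0$ with $\|s(z;\beta_0)\|\le K_1(1+\|z\|^{q_1})$ and $\|\frac{\partial}{\partial\beta}s(z;\beta_0)\|\le K_2(1+\|z\|^{q_2})$ for all $z$ and $\beta_0\in B$. (6) $\ell$ is $C^2$, and there are finite constants $K_3,K_4,K_5\ge0$ and integers $q_3,q_4,q_5\ge0$ with $|\ell(z;\theta)|\le K_3(1+\|z\|^{q_3})$, $\|\nabla_\theta\ell(z;\theta)\|\le K_4(1+\|z\|^{q_4})$, $\|\nabla_\theta^2\ell(z;\theta)\|\le K_5(1+\|z\|^{q_5})$ for all $z$ and $\theta\in\Theta$. (7) With $q_{\max}:=\max\{2q_1+q_3,\ q_2+q_3,\ 2q_3,\ 2q_4,\ q_1+q_4,\ q_5\}$,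 there are constants $M_k<\infty$ with $\sup_{\beta_0\in B}\mathbb E_{z\sim\mathcal D_{\beta_0}}[\|z\|^k]\le M_k$ for $0\le k\le q_{\max}$. (8) There are $\sigma_{\max}\ge0$ and $b_{\min}\in\mathbb N$ such that for every $\theta\in\Theta$ and $b\ge b_{\min}$, the estimator $\hat\beta=\mathrm{Pred}(\{z_i\}_{i=1}^b)\in B$ built from i.i.d. samples $z_i\sim\mathcal D_{\beta(\theta)}$ satisfies $\mathbb E[\|\hat\beta-\beta(\theta)\|^2]\le\sigma_{\max}^2/b$. Constants. $L_{\ell,\theta}^{\mathrm{Lip}},L_{\ell,\theta}^{\mathrm{sm}},L_{\beta,\theta}^{\mathrm{Lip}},L_{\beta,\theta}^{\mathrm{sm}},L_{G,\beta}^{\mathrm{Lip}},L_{G,\theta}^{\mathrm{Lip}},M_\ell,I_{\max}\ge0$ are finite constants such that for all $\theta,\theta'\in\Theta$ and $\beta_0,\beta_0'\in B$: $\sup_{\beta_1\in B}\mathbb E_{z\sim\mathcal D_{\beta_1}}[\|\nabla_\theta\ell(z;\theta)\|^2]^{1/2}\le L_{\ell,\theta}^{\mathrm{Lip}}$; $\mathbb E_{z\sim\mathcal D_{\beta(\theta)}}[\|\nabla_\theta\ell(z;\theta)-\nabla_\theta\ell(z;\theta')\|]\le L_{\ell,\theta}^{\mathrm{sm}}\|\theta-\theta'\|$; $\|\beta(\theta)-\beta(\theta')\|\le L_{\beta,\theta}^{\mathrm{Lip}}\|\theta-\theta'\|$; $\|\frac{\partial\beta}{\partial\theta}(\theta)-\frac{\partial\beta}{\partial\theta}(\theta')\|\le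 L_{\beta,\theta}^{\mathrm{sm}}\|\theta-\theta'\|$; $\|G(\theta;\beta_0)-G(\theta';\beta_0')\|\le L_{G,\beta}^{\mathrm{Lip}}\|\beta_0-\beta_0'\|+L_{G,\theta}^{\mathrm{Lip}}\|\theta-\theta'\|$; $\mathrm{Var}_{z\sim\mathcal D_{\beta_0}}[\ell(z;\theta)]\le M_\ell$; $\mathrm{Tr}(I(\beta_0))\le I_{\max}$. *)

(* Defs.v *)
From HB Require Import structures.
From mathcomp Require Import all_boot all_order all_algebra.
From mathcomp Require Import all_classical all_reals all_analysis.

Set Implicit Arguments.
Unset Strict Implicit.
Unset Printing Implicit Defensive.

Import Order.TTheory GRing.Theory Num.Theory.
Import numFieldNormedType.Exports.

Local Open Scope classical_set_scope.
Local Open Scope ring_scope.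

(* Vectors of R^k are row vectors.  The library norm on matrices is the sup
   norm, hence the explicit Euclidean and operator norms below; the topology
   and the differentials are the library ones, which do not depend on the
   choice of the norm. *)

(* R^k with its Borel sigma-algebra. *)
Notation Rvec R k := (g_sigma_algebraType (@open 'rV[R]_k)).

Section euclidean.
Context {R : realType}.

Definition dotv k (u v : 'rV[R]_k) : R := \sum_(i < k) u 0 i * v 0 i.

Definition enorm k (v : 'rV[R]_k) : R := Num.sqrt (\sum_(i < k) v 0 i ^+ 2).

(* Matrices act on row vectors on the right, as in the library Jacobian ['J]
   (the transpose of the usual one); transposition preserves this norm. *)
Definition opnorm k l (A : 'M[R]_(k, l)) : R :=
  sup [set enorm (v *m A) | v in [set v : 'rV[R]_k | enorm v <= 1]].

End euclidean.

Section differentiation.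
Context {R : realType}.

Definition grad k (f : 'rV[R]_k -> R) (x : 'rV[R]_k) : 'rV[R]_k :=
  \row_j 'D_(delta_mx 0 j) f x.

Definition hessian k (f : 'rV[R]_k -> R) (x : 'rV[R]_k) : 'M[R]_k :=
  'J (grad f) x.

(* [f] is of class C^r on the open set [U]; meant for finite-dimensional [V]. *)
Fixpoint Cdiff (r : nat) (V W : normedModType R) (U : set V) (f : V -> W)
    : Prop :=
  if r is r'.+1 then
    (forall x, U x -> differentiable f x) /\
    (forall v, Cdiff r' U (fun x => 'D_v f x))
  else forall x, U x -> {for x, continuous f}.

(* First-order expansion of [f] at [x] relative to [A]: [A] is the domain of
   [f] and [x] may be on its boundary. *)
Definition has_grad_within k (A : set 'rV[R]_k) (f : 'rV[R]_k -> R)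
    (x g : 'rV[R]_k) : Prop :=
  forall e : R, 0 < e -> \forall y \near within A (nbhs x),
    `|f y - f x - dotv g (y - x)| <= e * enorm (y - x).

End differentiation.

Section iid.
Context {R : realType} {dO dT : measure_display} {O : measurableType dO}
  {T : measurableType dT}.

Definition mutually_independent (P : probability O R) (b : nat)
    (X : 'I_b -> {RV P >-> T}) : Prop :=
  forall (J : {set 'I_b}) (A : 'I_b -> set T),
    (forall i, measurable (A i)) ->
    P (\bigcap_(i in [set` J]) (X i @^-1` A i)) =
    (\prod_(i in J) P (X i @^-1` A i))%E.

Definition iid_sample (P : probability O R) (Q : probability T R) (b : nat)
    (X : 'I_b -> {RV P >-> T}) : Prop :=
  mutually_independent X /\
  forall i (A : set T), measurable A -> distribution P (X i) A = Q A.

End iid.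

(* Real-valued expectation, for integrable [X]. *)
Definition Expect {R : realType} {dT : measure_display} {T : measurableType dT}
  (P : probability T R) (X : T -> R) : R := fine ('E_P[X])%E.

Section performative.
Context {R : realType} {n m d : nat}.
Implicit Types (Theta : set 'rV[R]_n) (B : set 'rV[R]_m) (Z : set (Rvec R d)).
Implicit Types (beta : 'rV[R]_n -> 'rV[R]_m) (ell : Rvec R d -> 'rV[R]_n -> R).
Implicit Types (D : 'rV[R]_m -> probability (Rvec R d) R).
Implicit Types (p : Rvec R d -> 'rV[R]_m -> R).
Implicit Types (mu : {sigma_finite_measure set (Rvec R d) -> \bar R}).
Implicit Types (Pred : forall k, k.-tuple (Rvec R d) -> 'rV[R]_m).

Definition Theta_delta Theta (delta : R) : set 'rV[R]_n :=
  [set t | Theta t /\ forall i : 'I_n,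
     Theta (t + delta *: delta_mx 0 i) /\ Theta (t - delta *: delta_mx 0 i)].

(* [D] and [p] are meaningful for parameters in [B] only; the densities are
   extended by 0 outside of the data space [Z]. *)
Record density_family mu Z B D p : Prop := {
  data_space_measurable : measurable Z ;
  density_measurable : forall b, B b -> measurable_fun [set: Rvec R d] (p ^~ b) ;
  density_ge0 : forall z b, B b -> 0 <= p z b ;
  density_out : forall z b, B b -> ~ Z z -> p z b = 0 ;
  densityE : forall b A, B b -> measurable A ->
    D b A = (\int[mu]_(z in A) (p z b)%:E)%E
}.

Definition posset p (b : 'rV[R]_m) : set (Rvec R d) := [set z | 0 < p z b].

(* [ln (p z b)] is undefined where [p z b = 0]; the score is set to 0 there. *)
Definition score p (z : Rvec R d) (b : 'rV[R]_m) : 'rV[R]_m :=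
  if 0 < p z b then grad (fun b' => ln (p z b')) b else 0.

Definition Gvec ell D p (t : 'rV[R]_n) (b : 'rV[R]_m) : 'rV[R]_m :=
  \row_j Expect (D b) (fun z => ell z t * score p z b 0 j).

Definition fisher D p (b : 'rV[R]_m) : 'M[R]_m :=
  \matrix_(i, j) Expect (D b) (fun z => score p z b 0 i * score p z b 0 j).

Definition perf_loss beta ell D (t : 'rV[R]_n) : R :=
  Expect (D (beta t)) (fun z => ell z t).

Definition perf_grad1 beta ell D (t : 'rV[R]_n) : 'rV[R]_n :=
  \row_j Expect (D (beta t)) (fun z => grad (ell z) t 0 j).

(* ['J beta t] is the transpose of the m x n Jacobian, so that this row vector
   is the transpose of (dbeta/dtheta)^T G. *)
Definition perf_grad2 beta ell D p (t : 'rV[R]_n) : 'rV[R]_n :=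
  Gvec ell D p t (beta t) *m ('J beta t)^T.

Definition perf_grad beta ell D p (t : 'rV[R]_n) : 'rV[R]_n :=
  perf_grad1 beta ell D t + perf_grad2 beta ell D p t.

(* Differentiation under the integral sign of [b |-> \int h(z, b) mu(dz)] at
   every point of [B].  The integrals are over the set where the density is
   positive: all the integrands [h] considered have [p] as a factor. *)
Definition diff_under_integral mu p B (h : Rvec R d -> 'rV[R]_m -> R) : Prop :=
  forall b, B b ->
  [/\ mu.-integrable (posset p b) (fun z => (h z b)%:E),
      forall j, mu.-integrable (posset p b) (fun z => (grad (h z) b 0 j)%:E)
    & has_grad_within B (fun b' => \int[mu]_(z in posset p b) h z b') b
        (\row_j \int[mu]_(z in posset p b) grad (h z) b 0 j)].

Definition q_max (q1 q2 q3 q4 q5 : nat) : nat :=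
  \max_(q <- [:: 2 * q1 + q3; q2 + q3; 2 * q3; 2 * q4; q1 + q4; q5]%N) q.

Record regularity Theta (delta : R) B beta Z ell mu D p Pred
    (q1 q2 q3 q4 q5 : nat) : Prop := {
  reg_Theta : [/\ Theta !=set0, closed Theta, convex_set Theta & compact Theta] ;
  reg_Theta_delta : let Td := Theta_delta Theta delta in
    [/\ Td !=set0, closed Td, convex_set Td & compact Td] ;
  reg_B : [/\ convex_set B, compact B & beta @` Theta `<=` B] ;
  reg_beta : Cdiff 3 setT beta ;
  reg_support : forall b b', B b -> B b' -> posset p b = posset p b' ;
  (* [p z] is C^2 on [B] as the restriction of a C^2 function on some open
     neighborhood of [B]. *)
  reg_p : forall z, Z z ->
    exists U : set 'rV[R]_m, [/\ open U, B `<=` U & Cdiff 2 U (p z)] ;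
  reg_int_p : diff_under_integral mu p B p ;
  reg_int_ell : forall t, Theta t ->
    diff_under_integral mu p B (fun z b => ell z t * p z b) ;
  reg_int_ell_score : forall t i, Theta t ->
    diff_under_integral mu p B (fun z b => ell z t * score p z b 0 i * p z b) ;
  reg_score : exists2 K1 : R, 0 <= K1 & forall z b, B b -> posset p b z ->
    enorm (score p z b) <= K1 * (1 + enorm (z : 'rV[R]_d) ^+ q1) ;
  reg_dscore : exists2 K2 : R, 0 <= K2 & forall z b, B b -> posset p b z ->
    opnorm ('J (score p z) b) <= K2 * (1 + enorm (z : 'rV[R]_d) ^+ q2) ;
  reg_ell : Cdiff 2 setT (fun x : 'rV[R]_d * 'rV[R]_n => ell x.1 x.2) ;
  reg_ell0 : exists2 K3 : R, 0 <= K3 & forall z t, Z z -> Theta t ->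
    `|ell z t| <= K3 * (1 + enorm (z : 'rV[R]_d) ^+ q3) ;
  reg_ell1 : exists2 K4 : R, 0 <= K4 & forall z t, Z z -> Theta t ->
    enorm (grad (ell z) t) <= K4 * (1 + enorm (z : 'rV[R]_d) ^+ q4) ;
  reg_ell2 : exists2 K5 : R, 0 <= K5 & forall z t, Z z -> Theta t ->
    opnorm (hessian (ell z) t) <= K5 * (1 + enorm (z : 'rV[R]_d) ^+ q5) ;
  reg_moments : exists M : nat -> R,
    forall k, (k <= q_max q1 q2 q3 q4 q5)%N ->
    (ereal_sup [set 'E_(D b)[(fun z : Rvec R d => enorm (z : 'rV[R]_d) ^+ k)%R]
               | b in B] <= (M k)%:E)%E ;
  reg_Pred_measurable : forall k,
    measurable_fun setT (Pred k : k.-tuple (Rvec R d) -> Rvec R m) ;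
  reg_Pred_B : forall k (x : k.-tuple (Rvec R d)),
    (forall i, Z (tnth x i)) -> B (Pred k x) ;
  reg_Pred_error : exists (sigma_max : R) (b_min : nat), 0 <= sigma_max /\
    forall t k, Theta t -> (0 < k)%N -> (b_min <= k)%N ->
    forall (dO : measure_display) (O : measurableType dO)
      (P : probability O R) (X : 'I_k -> {RV P >-> Rvec R d}),
    iid_sample (D (beta t)) X ->
    ('E_P[(fun w => enorm (Pred k [tuple X i w | i < k] - beta t) ^+ 2)%R]
       <= (sigma_max ^+ 2 / k%:R)%:E)%E
}.

Record smoothness_constants Theta B beta ell D p
    (Lell_lip Lell_sm Lbeta_lip Lbeta_sm LG_beta LG_theta Mell Imax : R)
    : Prop := {
  cst_ge0 : [/\ 0 <= Lell_lip, 0 <= Lell_sm, 0 <= Lbeta_lip & 0 <= Lbeta_sm] /\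
            [/\ 0 <= LG_beta, 0 <= LG_theta, 0 <= Mell & 0 <= Imax] ;
  cst_ell_lip : forall t, Theta t ->
    (ereal_sup [set 'E_(D b)[(fun z => enorm (grad (ell z) t) ^+ 2)%R]
                      `^ (2^-1)%R | b in B] <= Lell_lip%:E)%E ;
  cst_ell_sm : forall t t', Theta t -> Theta t' ->
    ('E_(D (beta t))[(fun z => enorm (grad (ell z) t - grad (ell z) t'))%R]
       <= (Lell_sm * enorm (t - t'))%:E)%E ;
  cst_beta_lip : forall t t', Theta t -> Theta t' ->
    enorm (beta t - beta t') <= Lbeta_lip * enorm (t - t') ;
  cst_beta_sm : forall t t', Theta t -> Theta t' ->
    opnorm ('J beta t - 'J beta t') <= Lbeta_sm * enorm (t - t') ;
  cst_G : forall t t' b b', Theta t -> Theta t' -> B b -> B b' ->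
    enorm (Gvec ell D p t b - Gvec ell D p t' b')
      <= LG_beta * enorm (b - b') + LG_theta * enorm (t - t') ;
  cst_var : forall t b, Theta t -> B b ->
    ('V_(D b)[(fun z => ell z t)%R] <= Mell%:E)%E ;
  cst_fisher : forall b, B b -> \tr (fisher D p b) <= Imax
}.

End performative.

(* Main.v *)
Require Import Defs.
From mathcomp Require Import all_boot all_order all_algebra.
From mathcomp Require Import all_classical all_reals all_analysis.
From mathcomp Require Import measurable_realfun ring lra.

(* Along a segment of [B] the increment of the density is dominated by the
   Riemann sums of its speed [p |s . v|].  Fatou's lemma and Cauchy-Schwarz at
   each node then give, for [f >= 0] with [E f^2 <= L^2] under every [D b],
     [\int f |p_b - p_b'| dmu <= L sqrt(Imax) |b - b'|].
   With [f] the norm of the loss gradient this bounds the variation of the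
   first part of the gradient; with [f] a loss increment it shows that moving
   both arguments of [E_(D (beta t)) ell(., t)] only costs a second-order term,
   which yields differentiability.
   For the second part, [|G| <= sqrt(Mell Imax)] is only available after
   centering the loss, i.e. up to a multiple of the mean score.  As [B] may
   have empty interior the mean score need not vanish, but it is orthogonal to
   the differences of points of [B], hence killed by the Jacobian of [beta].
   Similarly, the Lipschitz bound for [beta] on [Theta] controls its Jacobian in
   all directions because [Theta_delta] being nonempty forces [Theta] to
   contain a ball. *)

Set Implicit Arguments.
Unset Strict Implicit.
Unset Printing Implicit Defensive.

Import Order.TTheory GRing.Theory Num.Theory.
Import numFieldNormedType.Exports.

Local Open Scope classical_set_scope.
Local Open Scope ring_scope.

(** * Euclidean and operator norms *)

(** The Riemann sums of the speed converge with an error M(z)/(N+1), and nothing is known of how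
    M(z) depends on z. Fatou's lemma only asks for convergence at each z, while the integrals of the
    sums are bounded uniformly in N. At a node c of the segment the integrand f |s . v| p_c is an
    expectation under [D c]. Cauchy-Schwarz splits it into the L2 norm of f and the root of E|s|^2,
    which is the trace of the Fisher information at c. Hence the factors sqrt(Imax), and hence the
    need to control f in L2 under every law of the family and not only at the two ends. Points of
    [Theta] and [B] may lie on the boundary. Only directions pointing to other points of the set are
    then available, and convexity keeps the difference quotients inside the set. *)

Section euclidean_theory.
Context {R : realType}.

Lemma dotvE k (u v : 'rV[R]_k) : dotv u v = (u *m v^T) 0 0.
Proof. by rewrite mxE; apply: eq_bigr => i _; rewrite mxE. Qed.

Lemma dotvC k (u v : 'rV[R]_k) : dotv u v = dotv v u.
Proof. by apply: eq_bigr => i _; rewrite mulrC. Qed.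

Lemma dotvDl k (u v w : 'rV[R]_k) : dotv (u + v) w = dotv u w + dotv v w.
Proof. by rewrite !dotvE mulmxDl mxE. Qed.

Lemma dotvZl k (a : R) (u v : 'rV[R]_k) : dotv (a *: u) v = a * dotv u v.
Proof. by rewrite !dotvE -scalemxAl mxE. Qed.

Lemma dotvNl k (u v : 'rV[R]_k) : dotv (- u) v = - dotv u v.
Proof. by rewrite -scaleN1r dotvZl mulN1r. Qed.

Lemma dotvBl k (u v w : 'rV[R]_k) : dotv (u - v) w = dotv u w - dotv v w.
Proof. by rewrite dotvDl dotvNl. Qed.

Lemma dotvDr k (u v w : 'rV[R]_k) : dotv w (u + v) = dotv w u + dotv w v.
Proof. by rewrite dotvC dotvDl !(dotvC w). Qed.

Lemma dotvZr k (a : R) (u v : 'rV[R]_k) : dotv u (a *: v) = a * dotv u v.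
Proof. by rewrite dotvC dotvZl dotvC. Qed.

Lemma dotvBr k (u v w : 'rV[R]_k) : dotv w (u - v) = dotv w u - dotv w v.
Proof. by rewrite dotvC dotvBl !(dotvC w). Qed.

Lemma dotv_mulmx k l (u : 'rV[R]_k) (M : 'M[R]_(l, k)) (v : 'rV[R]_l) :
  dotv (u *m M^T) v = dotv u (v *m M).
Proof. by rewrite !dotvE trmx_mul mulmxA. Qed.

Lemma dotv_delta k (u : 'rV[R]_k) i : dotv u (delta_mx 0 i) = u 0 i.
Proof.
rewrite /dotv (bigD1 i)//= mxE !eqxx mulr1 big1 ?addr0// => j ji.
by rewrite mxE eqxx (negbTE ji) mulr0.
Qed.

Lemma dotvv_ge0 k (v : 'rV[R]_k) : 0 <= dotv v v.
Proof. by apply: sumr_ge0 => i _; rewrite -expr2 sqr_ge0. Qed.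

Lemma enormE k (v : 'rV[R]_k) : enorm v = Num.sqrt (dotv v v).
Proof. by congr Num.sqrt; apply: eq_bigr => i _; rewrite expr2. Qed.

Lemma enorm_ge0 k (v : 'rV[R]_k) : 0 <= enorm v.
Proof. exact: sqrtr_ge0. Qed.

Lemma enorm_sqr k (v : 'rV[R]_k) : enorm v ^+ 2 = dotv v v.
Proof. by rewrite enormE sqr_sqrtr// dotvv_ge0. Qed.

Lemma enorm0 k : enorm (0 : 'rV[R]_k) = 0.
Proof. by rewrite enormE -(scale0r 0) dotvZl mul0r sqrtr0. Qed.

Lemma enorm_coord k (v : 'rV[R]_k) i : `|(v 0 i)| <= enorm v.
Proof.
rewrite -sqrtr_sqr ler_sqrt; last by apply: sumr_ge0 => j _; rewrite sqr_ge0.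
by rewrite (bigD1 i)//= lerDl sumr_ge0// => j _; rewrite sqr_ge0.
Qed.

Lemma enorm_eq0 k (v : 'rV[R]_k) : enorm v = 0 -> v = 0.
Proof.
move=> v0; apply/rowP => i; rewrite mxE; apply/eqP; rewrite -normr_le0 -v0.
exact: enorm_coord.
Qed.

Lemma enormZ k (a : R) (v : 'rV[R]_k) : enorm (a *: v) = `|a| * enorm v.
Proof.
rewrite !enormE dotvZl dotvZr mulrA -expr2 sqrtrM ?sqr_ge0// sqrtr_sqr.
by [].
Qed.

Lemma enormN k (v : 'rV[R]_k) : enorm (- v) = enorm v.
Proof. by rewrite -scaleN1r enormZ normrN1 mul1r. Qed.

Lemma enormBC k (u v : 'rV[R]_k) : enorm (u - v) = enorm (v - u).
Proof. by rewrite -enormN opprB. Qed.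

Lemma dotv_le k (u v : 'rV[R]_k) : dotv u v <= enorm u * enorm v.
Proof.
have [v0|v0] := eqVneq (enorm v) 0.
  by rewrite (enorm_eq0 v0) enorm0 mulr0 -(scale0r 0) dotvZr mul0r.
have vp : 0 < enorm v by rewrite lt_def v0 enorm_ge0.
have [u0|u0] := eqVneq (enorm u) 0.
  by rewrite (enorm_eq0 u0) enorm0 mul0r -(scale0r 0) dotvZl mul0r.
have up : 0 < enorm u by rewrite lt_def u0 enorm_ge0.
(* The square of this vector is 2 |u| |v| (|u| |v| - u . v). *)
have := dotvv_ge0 (enorm v *: u - enorm u *: v).
rewrite dotvBl !dotvBr !dotvZl !dotvZr -!enorm_sqr (dotvC v u).
set a := enorm u; set b := enorm v; set c := dotv u v.
have ab : 0 < 2 * (a * b) by rewrite mulr_gt0// mulr_gt0.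
move=> h; have : 0 <= 2 * (a * b) * (a * b - c) by lra.
by rewrite pmulr_rge0// subr_ge0.
Qed.

Lemma CauchySchwarz_dotv k (u v : 'rV[R]_k) :
  `|dotv u v| <= enorm u * enorm v.
Proof.
rewrite ler_norml dotv_le andbT -(enormN u) lerNl -dotvNl; exact: dotv_le.
Qed.

Lemma ler_enormD k (u v : 'rV[R]_k) : enorm (u + v) <= enorm u + enorm v.
Proof.
rewrite -(@ler_pXn2r _ 2)// ?nnegrE ?addr_ge0 ?enorm_ge0//.
rewrite enorm_sqr dotvDl !dotvDr (dotvC v u) sqrrD !enorm_sqr.
have := dotv_le u v; lra.
Qed.

Lemma enorm_le_sum k (v : 'rV[R]_k) : enorm v <= \sum_(i < k) `|(v 0 i)|.
Proof.
have s0 : 0 <= \sum_(i < k) `|(v 0 i)| by apply: sumr_ge0.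
rewrite -(@ler_pXn2r _ 2)// ?nnegrE ?enorm_ge0// enorm_sqr /dotv.
rewrite expr2 mulr_suml; apply: ler_sum => i _.
apply: le_trans (ler_norm _) _; rewrite normrM ler_wpM2l//.
by rewrite (bigD1 i)//= lerDl sumr_ge0.
Qed.

(** With [norm_le_enorm], converts between the Euclidean norm and the sup norm that defines
    neighborhoods; the factor is not sharp. *)
Lemma enorm_le_norm k (v : 'rV[R]_k) : enorm v <= k%:R * `|v|.
Proof.
apply: le_trans (enorm_le_sum v) _.
rewrite (_ : k%:R * _ = \sum_(i < k) `|v|).
  by apply: ler_sum => i _; rewrite [leRHS]mx_normrE; exact: (le_bigmax _ _ (0, i)).
by rewrite sumr_const card_ord mulr_natl.
Qed.

Lemma norm_le_enorm k (v : 'rV[R]_k) : `|v| <= enorm v.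
Proof.
rewrite [leLHS]mx_normrE; apply: bigmax_le => [|[i j] _]; first exact: enorm_ge0.
by rewrite /= (ord1 i); exact: enorm_coord.
Qed.

(** Any constant would do: it only makes the set in [opnorm] bounded, so that its [sup] is a genuine
    supremum. *)
Lemma enorm_mulmx_le k l (M : 'M[R]_(k, l)) : exists2 c, 0 <= c &
  forall v : 'rV[R]_k, enorm (v *m M) <= c * enorm v.
Proof.
exists (\sum_(j < l) enorm (col j M)^T) => [|v].
  by apply: sumr_ge0 => j _; exact: enorm_ge0.
apply: le_trans (enorm_le_sum _) _; rewrite mulr_suml; apply: ler_sum => j _.
rewrite mulrC; apply: le_trans (CauchySchwarz_dotv _ _); rewrite le_eqVlt.
apply/orP; left; apply/eqP; congr (`|_|).
by rewrite mxE; apply: eq_bigr => i _; rewrite !mxE.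
Qed.

Lemma has_sup_opnorm k l (M : 'M[R]_(k, l)) :
  has_sup [set enorm (v *m M) | v in [set v : 'rV[R]_k | enorm v <= 1]].
Proof.
split; first by exists (enorm (0 *m M)), 0 => //=; rewrite enorm0.
have [c c0 cM] := enorm_mulmx_le M; exists c => _ [v /= v1 <-].
by apply: le_trans (cM v) _; rewrite ler_piMr.
Qed.

Lemma opnorm_ge0 k l (M : 'M[R]_(k, l)) : 0 <= opnorm M.
Proof.
rewrite -(enorm0 l) -(mul0mx 1 M); apply: ub_le_sup.
  by have [] := has_sup_opnorm M.
by exists 0 => //=; rewrite enorm0.
Qed.

Lemma enorm_mulmx k l (M : 'M[R]_(k, l)) (v : 'rV[R]_k) :
  enorm (v *m M) <= opnorm M * enorm v.
Proof.
have [v0|v0] := eqVneq (enorm v) 0.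
  by rewrite (enorm_eq0 v0) mul0mx !enorm0 mulr0.
have vp : 0 < enorm v by rewrite lt_def v0 enorm_ge0.
rewrite -ler_pdivrMr//.
have -> : enorm (v *m M) / enorm v = enorm (((enorm v)^-1 *: v) *m M).
  by rewrite -scalemxAl enormZ ger0_norm ?invr_ge0 ?enorm_ge0// mulrC.
apply: ub_le_sup; first by have [] := has_sup_opnorm M.
exists ((enorm v)^-1 *: v) => //=.
by rewrite enormZ ger0_norm ?invr_ge0 ?enorm_ge0// mulVf.
Qed.

Lemma opnorm_le k l (M : 'M[R]_(k, l)) (c : R) :
  0 <= c -> (forall v : 'rV[R]_k, enorm (v *m M) <= c * enorm v) ->
  opnorm M <= c.
Proof.
move=> c0 cM; apply: ge_sup; first by have [] := has_sup_opnorm M.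
by move=> _ [v /= v1 <-]; apply: le_trans (cM v) _; rewrite ler_piMr.
Qed.

(** With w = v M^T, one has |w|^2 = v . (w M) <= |v| opnorm(M) |w|. *)
Lemma enorm_mulmx_tr k l (M : 'M[R]_(k, l)) (v : 'rV[R]_l) :
  enorm (v *m M^T) <= opnorm M * enorm v.
Proof.
have [->|w0] := eqVneq (enorm (v *m M^T)) 0.
  by rewrite mulr_ge0 ?opnorm_ge0 ?enorm_ge0.
have wp : 0 < enorm (v *m M^T) by rewrite lt_def w0 enorm_ge0.
rewrite -(ler_pM2r wp) -expr2 enorm_sqr dotv_mulmx.
apply: le_trans (dotv_le _ _) _; rewrite mulrC mulrAC ler_wpM2r ?enorm_ge0//.
exact: enorm_mulmx.
Qed.

Lemma rowB k (u v : 'rV[R]_k) i : (u - v) 0 i = u 0 i - v 0 i.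
Proof. by rewrite !mxE. Qed.

Lemma rowZ k (a : R) (u : 'rV[R]_k) i : (a *: u) 0 i = a * u 0 i.
Proof. by rewrite mxE. Qed.

(** Meant for [s] the mean score and [M], [N] two Jacobians of [beta]: since both kill [s],
    centering [u] is free. *)
Lemma mulmx_trB_centered k l (u v s : 'rV[R]_l) (c : R) (M N : 'M[R]_(k, l)) :
  s *m M^T = 0 -> s *m N^T = 0 ->
  u *m M^T - v *m N^T = (u - c *: s) *m (M - N)^T + (u - v) *m N^T.
Proof.
move=> sM sN; rewrite (raddfB (@trmx R k l)) mulmxBr !mulmxBl -!scalemxAl sM sN.
by rewrite scaler0 !subr0 addrA subrK.
Qed.

End euclidean_theory.

(** * Segments, Taylor expansions and differentiability *)

Section segments.
Context {R : realType}.

Lemma convex_set_segment (V : lmodType R) (A : set V) (x y : V) (l : R) :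
  convex_set A -> A x -> A y -> 0 <= l <= 1 -> A (x + l *: (y - x)).
Proof.
move=> cA Ax Ay l01.
have cl := cA y x (Itv01 (proj1 (andP l01)) (proj2 (andP l01))).
move: cl; rewrite !inE => /(_ Ay Ax).
set w := conv _ _ _.
have -> : w = l *: y + (1 - l) *: x :> V by [].
by rewrite scalerBl scale1r scalerBr addrCA addrA.
Qed.

Lemma convex_set_barycenter (V : lmodType R) (A : set V) k (x : 'I_k -> V) :
  (0 < k)%N -> convex_set A -> (forall i, A (x i)) -> A (k%:R^-1 *: \sum_i x i).
Proof.
move=> + cA; case: k x => // k x _; elim: k x => [|k IH] x Ax.
  by rewrite big_ord1 invr1 scale1r.
have /(convex_set_segment cA (Ax ord_max)) :
    A (k.+1%:R^-1 *: \sum_(i < k.+1) x (widen_ord (leqnSn _) i)).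
  by apply: IH.
(* The barycenter of k+2 points lies on the segment from the last point to the barycenter of the
   others, at the fraction (k+1)/(k+2). *)
move=> /(_ (k.+1%:R / k.+2%:R)).
have c01 : (0 <= k.+1%:R / k.+2%:R :> R) && (k.+1%:R / k.+2%:R <= 1 :> R).
  by rewrite divr_ge0//= ler_pdivrMr// mul1r ler_nat.
move=> /(_ c01); congr (A _).
rewrite [in RHS]big_ord_recr/= scalerBr scalerA mulrAC divff// mul1r scalerDr.
rewrite addrC -addrA; congr (_ + _).
rewrite addrC -[X in X - _]scale1r -scalerBl; congr (_ *: _).
rewrite -[X in X - _](@divff _ k.+2%:R)// -mulrBl.
by rewrite -[k.+2%:R in X in X / _]natr1 addrAC subrr add0r mul1r.
Qed.

Lemma is_derive_line (V : normedModType R) (W : normedModType R) (F : V -> W)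
    (x v : V) (s : R) :
  derivable F (x + s *: v) v ->
  is_derive s 1 (fun s => F (x + s *: v)) ('D_v F (x + s *: v)).
Proof.
move=> dF.
have E : (fun h : R => h^-1 *: (((fun s => F (x + s *: v)) \o shift s) (h *: 1)
             - F (x + s *: v))) =
         (fun h => h^-1 *: ((F \o shift (x + s *: v)) (h *: v) - F (x + s *: v))).
  apply/funext => h /=; congr (_ *: (F _ - _)).
  by rewrite [h *: 1]mulr1 scalerDl addrCA.
by apply: DeriveDef; [rewrite /derivable E|rewrite /derive E].
Qed.

Lemma MVT_line (V : normedModType R) (F : V -> R) (x v : V) (a b : R) :
  a <= b ->
  (forall s, s \in `[a, b]%R -> derivable F (x + s *: v) v) ->
  exists2 c, c \in `[a, b]%R &
    F (x + b *: v) - F (x + a *: v) = 'D_v F (x + c *: v) * (b - a).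
Proof.
move=> ab dF.
apply: (@MVT_segment R (fun s => F (x + s *: v)) (fun s => 'D_v F (x + s *: v))).
- exact: ab.
- move=> s sab; apply: is_derive_line; apply: dF.
  by move: sab; rewrite !in_itv/= => /andP[/ltW-> /ltW->].
- apply: derivable_within_continuous => s sab.
  by have [] := is_derive_line (dF s sab).
Qed.

Lemma MVT_line01 (V : normedModType R) (F : V -> R) (x v : V) :
  (forall s, 0 <= s <= 1 -> derivable F (x + s *: v) v) ->
  exists2 c, 0 <= c <= 1 & F (x + v) - F x = 'D_v F (x + c *: v).
Proof.
move=> dF; have [s|c] := @MVT_line _ F x v 0 1 ler01.
- by rewrite in_itv/= => ?; exact: dF.
- move=> c01 E; exists c; first by move: c01; rewrite in_itv.
  by move: E; rewrite subr0 mulr1 scale1r scale0r addr0.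
Qed.

Lemma deriveZ_dir (V W : normedModType R) (F : V -> W) (x v : V) (a : R) :
  differentiable F x -> 'D_(a *: v) F x = a *: 'D_v F x.
Proof. by move=> dF; rewrite !deriveE// linearZ. Qed.

Lemma derive_dotv k (V : normedModType R) (g : V -> 'rV[R]_k) (u : 'rV[R]_k)
    (x v : V) :
  derivable g x v ->
  is_derive x v (fun y => dotv (g y) u) (dotv ('D_v g x) u).
Proof.
move=> dg; rewrite /dotv.
rewrite (_ : (fun y => _) = \sum_i (fun y => u 0 i *: g y 0 i)); last first.
  by apply/funext => y; rewrite fct_sumE; apply: eq_bigr => i _; rewrite mulrC.
have -> : \sum_(i < k) 'D_v g x 0 i * u 0 i =
          \sum_i u 0 i *: 'D_v (fun y => g y 0 i) x.
  by apply: eq_bigr => i _; rewrite derive_mx// mxE mulrC.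
apply: is_derive_sum => i; apply: is_deriveZ; apply: derivableP.
by move/derivable_mxP : dg; apply.
Qed.

Lemma dotv_grad k (f : 'rV[R]_k -> R) (x v : 'rV[R]_k) :
  differentiable f x -> dotv (grad f x) v = 'D_v f x.
Proof.
move=> df; rewrite [in RHS](row_sum_delta v) deriveE// linear_sum.
by apply: eq_bigr => i _; rewrite linearZ mxE deriveE// mulrC.
Qed.

Lemma differentiable_row (V : normedModType R) k (g : V -> 'rV[R]_k) (x : V) :
  (forall i, differentiable (fun y => g y 0 i) x) -> differentiable g x.
Proof.
move=> dg; rewrite (_ : g = \sum_i (fun y => g y 0 i *: delta_mx 0 i)).
  by apply: differentiable_sum => i; exact: differentiableZl.
by apply/funext => y; rewrite fct_sumE [LHS]row_sum_delta.
Qed.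

(** The mean value theorem is applied to [f], then to its derivative along [v]. The usual factor 1/2
    is lost, harmlessly: only the quadratic order matters later. *)
Lemma taylor2 k (f : 'rV[R]_k -> R) (x v : 'rV[R]_k) (K : R) :
  (forall s, 0 <= s <= 1 -> [/\ differentiable f (x + s *: v),
     differentiable (grad f) (x + s *: v) & opnorm (hessian f (x + s *: v)) <= K]) ->
  `|f (x + v) - f x - dotv (grad f x) v| <= K * enorm v ^+ 2.
Proof.
move=> H; have [s s01|c c01 ->] := @MVT_line01 _ f x v.
  by have [df _ _] := H s s01; exact: diff_derivable.
have [dfc _ _] := H c c01; rewrite -dotv_grad//.
have [c0 c1] := andP c01.
have sc s : 0 <= s <= 1 -> 0 <= s * c <= 1.
  by move=> /andP[s0 s1]; rewrite mulr_ge0//= mulr_ile1.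
have dg s : 0 <= s <= 1 -> derivable (grad f) (x + s *: (c *: v)) (c *: v).
  move=> s01; rewrite scalerA; apply: diff_derivable.
  by have [] := H _ (sc s s01).
have [s s01|s s01 ->] := @MVT_line01 _ (fun y => dotv (grad f y) v) x (c *: v).
  by have [] := derive_dotv v (dg s s01).
have [_ ->] := derive_dotv v (dg s s01).
rewrite scalerA; have [_ dgs Hs] := H _ (sc s s01).
rewrite deriveZ_dir// deriveEjacobian// dotvZl normrM (ger0_norm c0).
have K0 : 0 <= K by apply: le_trans (opnorm_ge0 _) Hs.
rewrite -[leRHS]mul1r; apply: ler_pM => //.
apply: le_trans (CauchySchwarz_dotv _ _) _.
rewrite expr2 mulrA ler_wpM2r ?enorm_ge0//.
by apply: le_trans (enorm_mulmx _ _) _; rewrite ler_wpM2r ?enorm_ge0.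
Qed.

(** M bounds the second derivative along the segment, by compactness of [0, 1]. On a piece of length
    1/(N+1) the speed departs from its value at the left node by at most M/(N+1), and the N+1 pieces
    add up to M. It matters that M is chosen before N. *)
Lemma increment_le_Riemann (V : normedModType R) (U : set V) (f : V -> R)
    (x v : V) :
  Cdiff 2 U f -> (forall s : R, 0 <= s <= 1 -> U (x + s *: v)) ->
  exists2 M : R, 0 <= M & forall N : nat,
    `|f (x + v) - f x| <=
      N.+1%:R^-1 * (\sum_(k < N.+1) `|'D_v f (x + (k%:R / N.+1%:R) *: v)| + M).
Proof.
move=> [df /(_ v)[df' /(_ v)/= cf'']] Us.
have cD : {within `[0, 1], continuous (fun s : R =>
    `|'D_v (fun x => 'D_v f x) (x + s *: v)|)}.
  apply/continuous_in_subspaceT => s; rewrite inE/= in_itv/= => s01.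
  apply: cvg_norm.
  have cl : {for s, continuous (fun s : R => x + s *: v)}.
    by apply: cvgD; [exact: cvg_cst|apply: cvgZr_tmp; exact: cvg_id].
  exact: (continuous_comp cl (cf'' _ (Us s s01))).
have [M M0 Mc] : exists2 M : R, 0 <= M & forall s : R, 0 <= s <= 1 ->
    `|'D_v (fun x => 'D_v f x) (x + s *: v)| <= M.
  have [c c01 Mc] := EVT_max ler01 cD.
  exists `|'D_v (fun x => 'D_v f x) (x + c *: v)| => [|s s01]; first exact: normr_ge0.
  by apply: Mc; rewrite in_itv.
exists M; [exact: M0|move=> N].
have d (s : R) : s \in `[0, 1] -> derivable f (x + s *: v) v.
  by rewrite in_itv/= => s01; exact/diff_derivable/df/Us.
have d' (s : R) : s \in `[0, 1] -> derivable (fun x => 'D_v f x) (x + s *: v) v.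
  by rewrite in_itv/= => s01; exact/diff_derivable/df'/Us.
have N0 : 0 < N.+1%:R :> R by [].
have step (k : nat) : (k < N.+1)%N ->
    `|f (x + (k.+1%:R / N.+1%:R) *: v) - f (x + (k%:R / N.+1%:R) *: v)| <=
    N.+1%:R^-1 * (`|'D_v f (x + (k%:R / N.+1%:R) *: v)| + M / N.+1%:R).
  move=> kN; set a := _ / _ *: v; set b := k%:R / _.
  have b0 : 0 <= b by rewrite divr_ge0.
  have eab : k.+1%:R / N.+1%:R = b + N.+1%:R^-1 :> R.
    by rewrite -natr1 mulrDl mul1r.
  have ab : b <= k.+1%:R / N.+1%:R by rewrite eab lerDl invr_ge0.
  have a1 : k.+1%:R / N.+1%:R <= 1 :> R by rewrite ler_pdivrMr// mul1r ler_nat.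
  have [s|s sab ->] := @MVT_line _ f x v b (k.+1%:R / N.+1%:R) ab.
    rewrite in_itv/= => /andP[bs sa]; apply: d; rewrite in_itv/=.
    by rewrite (le_trans b0)//= (le_trans sa).
  move: sab; rewrite in_itv/= => /andP[bs sa].
  rewrite normrM [X in _ * X]ger0_norm ?subr_ge0//.
  rewrite eab addrAC subrr add0r mulrC ler_wpM2l ?invr_ge0//.
  (* A second mean value theorem brings the speed at the intermediate point [s] back to the left
     node [b]. *)
  have [u|u ubs E] := @MVT_line _ (fun x => 'D_v f x) x v b s bs.
    rewrite in_itv/= => /andP[bu us]; apply: d'; rewrite in_itv/=.
    by rewrite (le_trans b0)//= (le_trans us)// (le_trans sa).
  rewrite -(subrK ('D_v f (x + b *: v)) ('D_v f (x + s *: v))).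
  apply: le_trans (ler_normD _ _) _; rewrite addrC lerD2l E normrM.
  move: ubs; rewrite in_itv/= => /andP[bu us].
  apply: ler_pM => //.
    by apply: Mc; rewrite (le_trans b0)//= (le_trans us)// (le_trans sa).
  by rewrite ger0_norm ?subr_ge0// lerBlDl -eab.
have -> : f (x + v) - f x = \sum_(k < N.+1)
    (f (x + (k.+1%:R / N.+1%:R) *: v) - f (x + (k%:R / N.+1%:R) *: v)).
  rewrite -(big_mkord xpredT (fun k =>
    f (x + (k.+1%:R / N.+1%:R) *: v) - f (x + (k%:R / N.+1%:R) *: v))).
  rewrite telescope_sumr// divff// scale1r mul0r scale0r addr0//.
apply: le_trans (ler_norm_sum _ _ _) _.
apply: (@le_trans _ _ (\sum_(k < N.+1)
  N.+1%:R^-1 * (`|'D_v f (x + (k%:R / N.+1%:R) *: v)| + M / N.+1%:R))).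
  by apply: ler_sum => k _; exact: step.
rewrite -mulr_sumr ler_wpM2l ?invr_ge0// big_split/= lerD2l.
by rewrite sumr_const card_ord -[leLHS]mulr_natr divfK.
Qed.

Lemma differentiable_near (V W : normedModType R) (f : V -> W) (x : V) (e : R) :
  differentiable f x -> 0 < e ->
  \forall h \near 0, `|f (h + x) - (f x + 'd f x h)| <= e * `|h|.
Proof.
move=> df e0; have /eqaddoP/(_ _ e0) :
    (fun h => f (h + x)) = (fun h => f x + 'd f x h) +o_ (nbhs 0) id.
  by apply/eqaddoE/funext => h; exact: diff_locallyx.
by apply: filterS => h.
Qed.

Lemma differentiable_taylor1 k l (f : 'rV[R]_k -> 'rV[R]_l) (x : 'rV[R]_k) :
  differentiable f x -> forall e : R, 0 < e ->
  \forall y \near x, enorm (f y - f x - (y - x) *m 'J f x) <= e * enorm (y - x).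
Proof.
move=> df e e0.
(* [l.+1] instead of [l], so that the division makes sense when l = 0. *)
have l0 : 0 < l.+1%:R :> R by [].
have el0 : 0 < e / l.+1%:R by rewrite divr_gt0.
have E := differentiable_near df el0.
rewrite (near_shift 0 x).
apply: filterS E => h /=; rewrite subr0 addrK /jacobian mul_rV_lin1 -addrA -opprD => E.
apply: le_trans (enorm_le_norm _) _.
apply: (@le_trans _ _ (l.+1%:R * (e / l.+1%:R * `|h|))).
  by apply: ler_pM => //; rewrite ler_nat.
by rewrite mulrA mulrCA divff// mulr1 ler_wpM2l ?(ltW e0)// norm_le_enorm.
Qed.

(** The bound h <= 1 keeps x + h v on the segment from x to x + v, hence in any convex set
    containing both ends. *)
Lemma differentiable_direction k l (f : 'rV[R]_k -> 'rV[R]_l)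
    (x v : 'rV[R]_k) (e : R) :
  differentiable f x -> 0 < e ->
  exists2 h : R, 0 < h <= 1 &
    enorm (h^-1 *: (f (x + h *: v) - f x) - v *m 'J f x) <= e.
Proof.
move=> df e0; have e'0 : 0 < e / (enorm v + 1).
  by rewrite divr_gt0// ltr_wpDl ?enorm_ge0.
have /nbhs_normP[/= r r0 H] := differentiable_taylor1 df e'0.
(* Small enough for |h v| < r; the [+ 1] covers v = 0. *)
pose h := Num.min 1 (r / (2 * (`|v| + 1))).
have v1 : 0 < `|v| + 1 by rewrite ltr_wpDl.
have h0 : 0 < h by rewrite lt_min ltr01/= divr_gt0// mulr_gt0.
exists h; first by rewrite h0/= ge_min lexx.
have hv : `|h *: v| < r.
  rewrite normrZ gtr0_norm//.
  have : h <= r / (2 * (`|v| + 1)) by rewrite ge_min lexx orbT.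
  rewrite ler_pdivlMr ?mulr_gt0// => hr.
  have : 0 <= `|v| by [].
  move: hr; set a := `|v|; nra.
have /H/= : ball_ Num.Def.normr x r (x + h *: v).
  by rewrite /ball_/= opprD addNKr normrN.
rewrite (_ : x + h *: v - x = h *: v); last by rewrite addrC addKr.
rewrite -scalemxAl enormZ gtr0_norm// => E.
have -> : h^-1 *: (f (x + h *: v) - f x) - v *m 'J f x =
    h^-1 *: (f (x + h *: v) - f x - h *: (v *m 'J f x)).
  by rewrite [in RHS]scalerBr scalerA mulVf ?gt_eqF// scale1r.
rewrite enormZ gtr0_norm ?invr_gt0// mulrC ler_pdivrMr//.
apply: le_trans E _; rewrite mulrCA mulrC ler_wpM2r ?(ltW h0)//.
rewrite mulrAC ler_pdivrMr ?ltr_wpDl ?enorm_ge0// ler_wpM2l ?(ltW e0)//.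
by rewrite lerDl.
Qed.

Lemma differentiable_partial (V W : normedModType R) (F : V * W -> R) z t :
  differentiable F (z, t) -> differentiable (fun t => F (z, t)) t.
Proof.
by move=> dF; apply: (@differentiable_comp _ _ _ _ (fun t => (z, t)) F);
  [exact: differentiable_pair|].
Qed.

(** Gradients of the loss in the model parameter become directional derivatives of the joint
    function. Its joint regularity then gives continuity in [z], hence measurability. *)
Lemma derive_partial (V W : normedModType R) (F : V * W -> R) z t v :
  'D_v (fun t => F (z, t)) t = 'D_(0, v) F (z, t).
Proof.
rewrite /derive; set g1 := (fun h => _); set g2 := (fun h => _ *: (_ - F _)).
suff -> : g1 = g2 by [].
apply/funext => h; rewrite /g1 /g2 /=; congr (_ *: (F _ - _)).
by congr pair; rewrite /= scaler0 add0r.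
Qed.

Lemma continuous_partial (V W : normedModType R) (F : V * W -> R) t :
  (forall z, {for (z, t), continuous F}) -> continuous (fun z => F (z, t)).
Proof.
move=> cF z; apply: (@cvg_comp _ _ _ (fun z => (z, t)) F _ (nbhs (z, t))).
  by apply: cvg_pair; [exact: cvg_id|exact: cvg_cst].
exact: cF.
Qed.

Lemma measurable_fun_Rvec k (f : 'rV[R]_k -> R) :
  continuous f -> measurable_fun [set: Rvec R k] (f : Rvec R k -> R).
Proof.
move=> /continuousP cf; apply: (measurability _ (RGenOpens.measurableE R)).
move=> _ [_ [a [b ->] <-]]; rewrite setTI.
by apply: sub_sigma_algebra; apply: cf; exact: interval_open.
Qed.

Lemma continuous_enorm k : continuous (@enorm R k).
Proof.
suff H (x : 'rV[R]_k) (e : R) : 0 < e ->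
    \forall y \near x, `|enorm x - enorm y| <= e.
  move=> x; have FF : Filter (nbhs x) by exact: nbhs_filter.
  by apply/(@cvgrPdist_le _ _ _ (nbhs x) FF) => e; exact: H.
move=> e0; have k0 : 0 < k.+1%:R :> R by [].
apply/nbhs_normP; exists (e / k.+1%:R) => /=; first by rewrite divr_gt0.
move=> y /=; rewrite ltr_pdivlMr// => /ltW xy.
apply: (@le_trans _ _ (enorm (x - y))).
  rewrite ler_distl; apply/andP; split.
    have := ler_enormD (y - x) x; rewrite subrK (enormBC y x); lra.
  have := ler_enormD (x - y) y; rewrite subrK; lra.
apply: le_trans (enorm_le_norm _) _; apply: le_trans _ xy.
by rewrite mulrC ler_wpM2l// ler_nat.
Qed.

End segments.

(** * Densities and integral inequalities *)

Section limn_einf_bounds.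
Context {R : realType}.
Implicit Types (u : (\bar R)^nat) (x : \bar R).
Local Open Scope ereal_scope.

Lemma limn_einfE u : limn_einf u = ereal_sup (range (einfs u)).
Proof. by rewrite limn_einf_lim; apply/cvg_lim => //; exact: cvg_einfs_sup. Qed.

Lemma limn_einf_ge u x N : (forall k, (N <= k)%N -> x <= u k) -> x <= limn_einf u.
Proof.
move=> xu; rewrite limn_einfE; apply: (@le_trans _ _ (einfs u N)).
  by apply: le_ereal_inf_tmp => _ [k /= Nk <-]; exact: xu.
by apply: ereal_sup_ubound; exists N.
Qed.

Lemma limn_einf_le u x : (forall k, u k <= x) -> limn_einf u <= x.
Proof.
move=> ux; rewrite limn_einfE; apply: ge_ereal_sup => _ [k _ <-].
by apply: le_trans (ux k); apply: ereal_inf_lbound; exists k => /=.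
Qed.

End limn_einf_bounds.

(** * Integrals against a measure given by a density *)

Section density.
Context {R : realType} d (T : measurableType d).
Variables (mu nu : {measure set T -> \bar R}) (q : T -> R).
Hypotheses (mq : measurable_fun setT q) (q0 : forall x, 0 <= q x)
  (nuE : forall A, measurable A -> nu A = (\int[mu]_(x in A) (q x)%:E)%E).
Local Open Scope ereal_scope.
Import HBNNSimple.

Let mqE : measurable_fun setT (EFin \o q).
Proof. exact/measurable_EFinP. Qed.

Lemma integral_density_nnsfun (h : {nnsfun T >-> R}) :
  \int[nu]_x (h x)%:E = \int[mu]_x ((h x)%:E * (q x)%:E).
Proof.
have mi (r : R) : measurable (h @^-1` [set r]) by [].
have mhi (r : R) : measurable_fun setT (fun x => (r * \1_(h @^-1` [set r]) x)%:E).
  by apply/measurable_EFinP; apply: measurable_funM.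
have hE x : (h x)%:E = \sum_(y \in range h) (y * \1_(h @^-1` [set y]) x)%:E.
  by rewrite fsumEFin// -fimfunE.
under eq_integral do rewrite hE.
rewrite ge0_integral_fsum//; last by move=> r x _; exact: nnfun_muleindic_ge0.
under [RHS]eq_integral.
  move=> x _; rewrite hE ge0_mule_fsuml; last first.
    by move=> r; exact: nnfun_muleindic_ge0.
  over.
rewrite ge0_integral_fsum//; last 2 first.
- by move=> r; apply: emeasurable_funM.
- by move=> r x _; rewrite mule_ge0 ?lee_fin// -lee_fin nnfun_muleindic_ge0.
apply: eq_fsbigr => r /[!inE] -[t _ <-].
under eq_integral do rewrite EFinM.
rewrite ge0_integralZl ?lee_fin//; last first.
  exact/measurable_EFinP.
under [RHS]eq_integral do rewrite EFinM -muleA.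
rewrite [RHS]ge0_integralZl ?lee_fin//; last 2 first.
- by apply: emeasurable_funM => //; exact/measurable_EFinP.
- by move=> x _; rewrite mule_ge0 ?lee_fin.
congr (_ * _); rewrite integral_indic// setIT nuE// integral_mkcond.
apply: eq_integral => x _; rewrite patchE indicE.
by case: ifPn => _; rewrite ?mul1e ?mul0e.
Qed.

(** Monotone convergence on both sides from the case of simple functions; [q0] keeps the products
    with [q] nondecreasing. *)
Lemma ge0_integral_density (f : T -> \bar R) :
  measurable_fun setT f -> (forall x, 0 <= f x) ->
  \int[nu]_x f x = \int[mu]_x (f x * (q x)%:E).
Proof.
move=> mf f0; pose h := nnsfun_approx measurableT mf.
have hf x : (h n x)%:E @[n --> \oo] --> f x by exact: cvg_nnsfun_approx.
have hn x : {homo (fun n => h n x) : a b / (a <= b)%N >-> (a <= b)%R}.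
  by move=> a b ab; exact/lefP/nd_nnsfun_approx.
transitivity (limn (fun n => \int[nu]_x (h n x)%:E)).
  rewrite -monotone_convergence//.
  - by apply: eq_integral => x _; apply/esym/cvg_lim => //; exact: hf.
  - by move=> n; exact/measurable_EFinP.
  - by move=> n x _; rewrite lee_fin.
  - by move=> x _ a b ab; rewrite lee_fin; exact: hn.
under eq_fun do rewrite integral_density_nnsfun.
rewrite -monotone_convergence//.
- apply: eq_integral => x _; apply/cvg_lim => //.
  by apply: cvgeZr => //; exact: hf.
- by move=> n; apply: emeasurable_funM => //; exact/measurable_EFinP.
- by move=> n x _; rewrite mule_ge0 ?lee_fin.
- by move=> x _ a b ab; rewrite lee_wpmul2r ?lee_fin//; exact: hn.
Qed.

Lemma integrable_density (f : T -> R) : measurable_fun setT f ->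
  nu.-integrable setT (EFin \o f) <->
  mu.-integrable setT (fun x => (f x * q x)%:E).
Proof.
move=> mf.
have mfE : measurable_fun setT (EFin \o f) by exact/measurable_EFinP.
have mfq : measurable_fun setT (fun x => (f x * q x)%:E).
  by apply/measurable_EFinP; exact: measurable_funM.
have E : \int[nu]_x `|(EFin \o f) x| = \int[mu]_x `|(f x * q x)%:E|.
  rewrite ge0_integral_density//; last exact: measurableT_comp.
  by apply: eq_integral => x _; rewrite /= normrM (ger0_norm (q0 x)) EFinM.
by split=> /integrableP[_ H]; apply/integrableP; split => //; move: H; rewrite E.
Qed.

Lemma Rintegral_density (f : T -> R) : measurable_fun setT f ->
  nu.-integrable setT (EFin \o f) ->
  (\int[nu]_x f x = \int[mu]_x (f x * q x))%R.
Proof.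
move=> mf fi; rewrite /Rintegral; congr fine.
have mfE : measurable_fun setT (EFin \o f) by exact/measurable_EFinP.
rewrite integralE [RHS]integralE.
rewrite !ge0_integral_density//; try exact: measurable_funepos;
  try exact: measurable_funeneg.
(* As q >= 0, multiplication by q commutes with taking positive and negative parts. *)
by congr (_ - _); apply: eq_integral => x _;
  rewrite ?funeposE ?funenegE -?EFinN -!EFin_max -EFinM maxr_pMl// ?mul0r ?mulNr.
Qed.

End density.

Section CauchySchwarz.
Context {R : realType} d (T : measurableType d).
Variable P : {measure set T -> \bar R}.
Local Open Scope ereal_scope.

(** Phrased with bounds [a], [b] in place of the L2 norms, which may vanish. With A = a + e and B =
    b + e positive, integrate f g <= (B/A) f^2 / 2 + (A/B) g^2 / 2 to get A B, then let e tend to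
    0. *)
Lemma integral_CauchySchwarz (f g : T -> R) (a b : R) :
  measurable_fun setT f -> measurable_fun setT g ->
  (forall x, (0 <= f x)%R) -> (forall x, (0 <= g x)%R) ->
  (0 <= a)%R -> (0 <= b)%R ->
  \int[P]_x (f x ^+ 2)%:E <= (a ^+ 2)%:E ->
  \int[P]_x (g x ^+ 2)%:E <= (b ^+ 2)%:E ->
  \int[P]_x (f x * g x)%:E <= (a * b)%:E.
Proof.
move=> mf mg f0 g0 a0 b0 fa gb.
have mf2 : measurable_fun setT (fun x => (f x ^+ 2)%:E).
  by apply/measurable_EFinP; exact: measurable_funX.
have mg2 : measurable_fun setT (fun x => (g x ^+ 2)%:E).
  by apply/measurable_EFinP; exact: measurable_funX.
suff H (e : R) : (0 < e)%R -> \int[P]_x (f x * g x)%:E <= ((a + e) * (b + e))%:E.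
  have : \int[P]_x (f x * g x)%:E \is a fin_num.
    rewrite ge0_fin_numE ?integral_ge0// => [|x _]; last by rewrite lee_fin mulr_ge0.
    by apply: le_lt_trans (H _ ltr01) _; rewrite ltry.
  move=> /fineK E; rewrite -E lee_fin; apply/ler_addgt0Pr => e e0.
  have c0 : (0 < a + b + 1)%R by rewrite ltr_wpDl// addr_ge0.
  (* As e' <= 1, (a + e')(b + e') <= a b + e' (a + b + 1) <= a b + e. *)
  pose e' := Num.min 1%R (e / (a + b + 1))%R.
  have e'0 : (0 < e')%R by rewrite lt_min ltr01 divr_gt0.
  have e'1 : (e' <= 1)%R by rewrite ge_min lexx.
  have e'e : (e' * (a + b + 1) <= e)%R.
    by rewrite -ler_pdivlMr// ge_min lexx orbT.
  by have := H _ e'0; rewrite -E lee_fin; nra.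
move=> e0; pose A := (a + e)%R; pose B := (b + e)%R.
have A0 : (0 < A)%R by rewrite ltr_wpDl.
have B0 : (0 < B)%R by rewrite ltr_wpDl.
pose c := (B / A / 2)%R; pose c' := (A / B / 2)%R.
have c0 : (0 <= c)%R by rewrite !divr_ge0// ltW.
have c'0 : (0 <= c')%R by rewrite !divr_ge0// ltW.
apply: (@le_trans _ _ (\int[P]_x (c%:E * (f x ^+ 2)%:E + c'%:E * (g x ^+ 2)%:E))).
  apply: ge0_le_integral => //.
  - by move=> x _; rewrite lee_fin mulr_ge0.
  - by apply/measurable_EFinP; exact: measurable_funM.
  - by apply: emeasurable_funD; apply: emeasurable_funM.
  - move=> x _; rewrite lee_fin -subr_ge0 /c /c'.
    have -> : (B / A / 2 * f x ^+ 2 + A / B / 2 * g x ^+ 2 - f x * g x =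
       (B * f x - A * g x) ^+ 2 / (2 * A * B))%R by field; rewrite !gt_eqF.
    by rewrite divr_ge0 ?sqr_ge0// !mulr_ge0// ltW.
rewrite ge0_integralD//; last 4 first.
- by move=> x _; rewrite lee_fin mulr_ge0 ?sqr_ge0.
- by apply: emeasurable_funM.
- by move=> x _; rewrite lee_fin mulr_ge0 ?sqr_ge0.
- by apply: emeasurable_funM.
rewrite !ge0_integralZl_EFin//; try by move=> x _; rewrite lee_fin sqr_ge0.
apply: (@le_trans _ _ (c%:E * (a ^+ 2)%:E + c'%:E * (b ^+ 2)%:E)).
  by apply: leeD; apply: lee_wpmul2l.
rewrite -!EFinM -EFinD lee_fin /c /c'.
have aA : (a ^+ 2 <= A ^+ 2)%R by rewrite ler_sqr ?nnegrE ?(ltW A0)// lerDl ltW.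
have bB : (b ^+ 2 <= B ^+ 2)%R by rewrite ler_sqr ?nnegrE ?(ltW B0)// lerDl ltW.
have -> : (A * B = B / A / 2 * A ^+ 2 + A / B / 2 * B ^+ 2)%R.
  by field; rewrite !gt_eqF.
by rewrite lerD// ler_wpM2l.
Qed.

End CauchySchwarz.

(** * Vector-valued integrals, taken coordinate by coordinate *)

Section vector_integral.
Context {R : realType} d (T : measurableType d).

Lemma measurable_fun_dotv k (X Y : T -> 'rV[R]_k) :
  (forall j, measurable_fun setT (fun x => X x 0 j)) ->
  (forall j, measurable_fun setT (fun x => Y x 0 j)) ->
  measurable_fun setT (fun x => dotv (X x) (Y x)).
Proof. by move=> mX mY; apply: measurable_sum => j; exact: measurable_funM. Qed.

Lemma measurable_fun_enorm k (X : T -> 'rV[R]_k) :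
  (forall j, measurable_fun setT (fun x => X x 0 j)) ->
  measurable_fun setT (fun x => enorm (X x)).
Proof.
move=> mX; rewrite (_ : (fun x => _) = Num.sqrt \o (fun x => dotv (X x) (X x))).
  apply: measurableT_comp; last exact: measurable_fun_dotv.
  by apply: continuous_measurable_fun; exact: sqrt_continuous.
by apply/funext => x; rewrite /= enormE.
Qed.

Variable P : {measure set T -> \bar R}.

Lemma enorm_integrable k (X : T -> 'rV[R]_k) (c : R) :
  (forall j, measurable_fun setT (fun x => X x 0 j)) ->
  (\int[P]_x (enorm (X x))%:E <= c%:E)%E ->
  forall j, P.-integrable setT (fun x => (X x 0 j)%:E).
Proof.
move=> mX Xc j; apply/integrableP; split; first exact/measurable_EFinP.
apply: (@le_lt_trans _ _ c%:E); last by rewrite ltry.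
apply: le_trans Xc; apply: ge0_le_integral => //.
- by apply/measurable_EFinP; exact: measurableT_comp.
- by apply/measurable_EFinP; exact: measurable_fun_enorm.
- by move=> x _; rewrite lee_fin enorm_coord.
Qed.

Lemma integrable_dotv k (X : T -> 'rV[R]_k) (u : 'rV[R]_k) :
  (forall j, P.-integrable setT (fun x => (X x 0 j)%:E)) ->
  P.-integrable setT (fun x => (dotv (X x) u)%:E).
Proof.
move=> iX; rewrite /dotv; under eq_fun do rewrite -sumEFin.
apply: integrable_sum => // j _; under eq_fun do rewrite EFinM.
exact: integrableZr.
Qed.

Lemma Rintegral_dotv k (X : T -> 'rV[R]_k) (u : 'rV[R]_k) :
  (forall j, P.-integrable setT (fun x => (X x 0 j)%:E)) ->
  \int[P]_x dotv (X x) u = dotv (\row_j \int[P]_x X x 0 j) u.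
Proof.
move=> iX; have iu j : P.-integrable setT (fun x => (X x 0 j * u 0 j)%:E).
  by under eq_fun do rewrite EFinM; exact: integrableZr.
rewrite /Rintegral /dotv; under eq_integral do rewrite -sumEFin.
rewrite integral_sum// -sum_fine; last by move=> j _; exact: integrable_fin_num.
apply: eq_bigr => j _; rewrite mxE -[LHS]/(Rintegral P setT (fun x => X x 0 j * u 0 j)).
by rewrite RintegralZr//; exact: iX.
Qed.

(** Test the integral u against itself: |u|^2 is the integral of X . u, at most |u| times that of
    |X|. *)
Lemma enorm_Rintegral_le k (X : T -> 'rV[R]_k) (c : R) :
  (forall j, measurable_fun setT (fun x => X x 0 j)) ->
  (\int[P]_x (enorm (X x))%:E <= c%:E)%E ->
  enorm (\row_j \int[P]_x X x 0 j) <= c.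
Proof.
move=> mX Xc; have iX := enorm_integrable mX Xc.
set u := \row_j _.
have c0 : 0 <= c.
  by rewrite -lee_fin; apply: le_trans Xc; apply: integral_ge0 => x _;
     rewrite lee_fin enorm_ge0.
have [->//|u0] := eqVneq (enorm u) 0.
have up : 0 < enorm u by rewrite lt_def u0 enorm_ge0.
rewrite -(ler_pM2l up) -expr2 enorm_sqr {1}/u -Rintegral_dotv//.
have mE : measurable_fun setT (fun x => (enorm (X x))%:E).
  by apply/measurable_EFinP; exact: measurable_fun_enorm.
have iE : P.-integrable setT (fun x => (enorm (X x))%:E).
  apply/integrableP; split => //; apply: (@le_lt_trans _ _ c%:E); last by rewrite ltry.
  by under eq_integral do rewrite gee0_abs ?lee_fin ?enorm_ge0//.
rewrite -lee_fin fineK ?integrable_fin_num//; last exact: integrable_dotv.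
apply: (@le_trans _ _ (\int[P]_x ((enorm u)%:E * (enorm (X x))%:E))%E).
  apply: le_integral => //; [exact: integrable_dotv|exact: integrableZl|].
  by move=> x _; rewrite lee_fin mulrC dotv_le.
rewrite ge0_integralZl_EFin//; last exact: enorm_ge0.
  by rewrite EFinM lee_wpmul2l// lee_fin enorm_ge0.
by move=> x _; rewrite lee_fin enorm_ge0.
Qed.

End vector_integral.

(** * Variation of an integral along a segment of parameters *)

Section density_difference.
Context {R : realType} {dT : measure_display} {T : measurableType dT} {m : nat}.
Variables (mu : {measure set T -> \bar R}) (B : set 'rV[R]_m).
Variables (p : T -> 'rV[R]_m -> R) (D : 'rV[R]_m -> probability T R).
Variables (s : T -> 'rV[R]_m -> 'rV[R]_m) (J : R).
Hypotheses (cB : convex_set B) (J0 : 0 <= J)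
  (mp : forall b, B b -> measurable_fun setT (p ^~ b))
  (p0 : forall z b, B b -> 0 <= p z b)
  (DE : forall b A, B b -> measurable A -> D b A = (\int[mu]_(z in A) (p z b)%:E)%E)
  (ms : forall b j, B b -> measurable_fun setT (fun z => s z b 0 j))
  (sJ : forall b, B b -> (\int[D b]_z (enorm (s z b) ^+ 2)%:E <= J%:E)%E)
  (dp : forall b b' z, B b -> B b' -> exists M : R, forall N : nat,
     `|p z b' - p z b| <= N.+1%:R^-1 * (\sum_(k < N.+1)
        `|p z (b + (k%:R / N.+1%:R) *: (b' - b)) *
          dotv (s z (b + (k%:R / N.+1%:R) *: (b' - b))) (b' - b)| + M)).

(* Fatou along the left Riemann sums of [t |-> f |d/dt p(b + t (b' - b))|],
   each term of which is bounded by Cauchy-Schwarz; this spares the joint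
   measurability that Fubini would require. *)
Lemma integral_density_difference_le (f : T -> R) (L : R) (b b' : 'rV[R]_m) :
  measurable_fun setT f -> (forall z, 0 <= f z) -> 0 <= L ->
  (forall c, B c -> (\int[D c]_z (f z ^+ 2)%:E <= (L ^+ 2)%:E)%E) ->
  B b -> B b' ->
  (\int[mu]_z (f z * `|p z b' - p z b|)%:E <=
    (L * Num.sqrt J * enorm (b' - b))%:E)%E.
Proof.
move=> mf f0 L0 fL Bb Bb'; set v := b' - b.
pose bk N k := b + (k%:R / N.+1%:R) *: v.
have Bbk N (k : 'I_N.+1) : B (bk N k).
  apply: convex_set_segment => //.
  by rewrite divr_ge0//= ler_pdivrMr// mul1r ler_nat ltnW.
pose h N (k : 'I_N.+1) z := f z * `|dotv (s z (bk N k)) v|.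
have mh N (k : 'I_N.+1) : measurable_fun setT (h N k).
  apply: measurable_funM => //; apply: measurableT_comp => //.
  apply: measurable_fun_dotv => j; last exact: measurable_cst.
  exact: ms.
have h0 N (k : 'I_N.+1) z : 0 <= h N k z by rewrite mulr_ge0.
have mhp N (k : 'I_N.+1) :
    measurable_fun setT (fun z => ((h N k z)%:E * (p z (bk N k))%:E)%E).
  by apply: emeasurable_funM; apply/measurable_EFinP => //; exact: mp.
have hp0 N (k : 'I_N.+1) z : (0 <= (h N k z)%:E * (p z (bk N k))%:E)%E.
  by rewrite mule_ge0 ?lee_fin// p0.
pose g N z := (N.+1%:R^-1%:E * \sum_(k < N.+1) (h N k z)%:E * (p z (bk N k))%:E)%E.
have gE N z : g N z = (f z * (N.+1%:R^-1 * \sum_(k < N.+1)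
        `|p z (bk N k) * dotv (s z (bk N k)) v|))%:E.
  rewrite /g; under eq_bigr do rewrite -EFinM.
  rewrite sumEFin -EFinM; congr EFin; rewrite mulrCA; congr (_ * _).
  rewrite mulr_sumr.
  apply: eq_bigr => k _; rewrite /h normrM (ger0_norm (p0 _ _)) ?mulrA//.
  by rewrite mulrAC.
have gS N : (\int[mu]_z g N z <= (L * Num.sqrt J * enorm v)%:E)%E.
  have msum : measurable_fun setT
      (fun z => (\sum_(k < N.+1) (h N k z)%:E * (p z (bk N k))%:E)%E).
    exact: emeasurable_sum.
  rewrite ge0_integralZl_EFin//; last first.
    by move=> z _; apply: sume_ge0 => k _.
  rewrite ge0_integral_sum//.
  apply: (@le_trans _ _ (N.+1%:R^-1%:E *
      \sum_(k < N.+1) (L * Num.sqrt J * enorm v)%:E)%E).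
    apply: lee_wpmul2l; first by rewrite lee_fin.
    apply: lee_sum => k _.
    (* Back to an expectation under the law at the node, where [fL] and [sJ] apply. *)
    rewrite -(ge0_integral_density (mp (Bbk N k)) (fun z => p0 z (Bbk N k))
       (fun A => DE (Bbk N k))); last 2 first.
    - by apply/measurable_EFinP; exact: mh.
    - by move=> z; rewrite lee_fin.
    rewrite -mulrA; apply: integral_CauchySchwarz => //.
    - apply: measurableT_comp => //.
      by apply: measurable_fun_dotv => j; [exact: ms|exact: measurable_cst].
    - by rewrite mulr_ge0 ?enorm_ge0.
    - exact: fL.
    rewrite exprMn sqr_sqrtr// EFinM muleC.
    apply: (@le_trans _ _ (\int[D (bk N k)]_z
       ((enorm v ^+ 2)%:E * (enorm (s z (bk N k)) ^+ 2)%:E))%E).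
      apply: ge0_le_integral => //.
      - apply/measurable_EFinP; apply: measurable_funX.
        apply: measurableT_comp => //.
        by apply: measurable_fun_dotv => j; [exact: ms|exact: measurable_cst].
      - apply: emeasurable_funM => //; apply/measurable_EFinP.
        by apply: measurable_funX; apply: measurable_fun_enorm => j; exact: ms.
      - move=> z _; rewrite lee_fin -exprMn mulrC ler_sqr ?nnegrE ?mulr_ge0 ?enorm_ge0//.
        exact: CauchySchwarz_dotv.
    rewrite ge0_integralZl_EFin ?sqr_ge0//.
    - by rewrite lee_wpmul2l ?lee_fin ?sqr_ge0// sJ.
    - by move=> z _; rewrite lee_fin sqr_ge0.
    - apply/measurable_EFinP.
      by apply: measurable_funX; apply: measurable_fun_enorm => j; exact: ms.
  rewrite sumEFin sumr_const card_ord -EFinM -[X in (_ * X)%:E]mulr_natl mulrA mulVf//.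
  by rewrite mul1r.
apply: le_trans (limn_einf_le gS).
apply: le_trans (fatou mu measurableT _ _); last 2 first.
- move=> N; apply: emeasurable_funM => //; exact: emeasurable_sum.
- by move=> N z _; rewrite mule_ge0 ?lee_fin// sume_ge0.
apply: ge0_le_integral => //.
- by move=> z _; rewrite lee_fin mulr_ge0.
- apply/measurable_EFinP; apply: measurable_funM => //.
  by apply: measurableT_comp => //; apply: measurable_funB; exact: mp.
- apply: measurableT_comp => //; apply: measurable_fun_limn_esup => N.
  apply: measurableT_comp => //; apply: emeasurable_funM => //.
  exact: emeasurable_sum.
move=> z _.
(* What remains is pointwise: for this [z] the sums [g N z] fall short of the left-hand side by at
   most C/(N+1), which is below e as soon as N >= C/e. *)
have [M HM] := dp z Bb Bb'.
apply/lee_addgt0Pr => e e0.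
pose C := `|f z * M|; have C0 : 0 <= C := normr_ge0 _.
rewrite -leeBlDr//.
apply: (@limn_einf_ge _ _ _ (Num.truncn (C / e))) => N eN.
rewrite gE -EFinB lee_fin lerBlDr.
apply: (@le_trans _ _ (f z * (N.+1%:R^-1 * (\sum_(k < N.+1)
        `|p z (bk N k) * dotv (s z (bk N k)) v| + M)))).
  by rewrite ler_wpM2l.
rewrite mulrDr mulrDr lerD2l.
apply: (@le_trans _ _ (N.+1%:R^-1 * C)).
  by rewrite mulrCA ler_wpM2l// ler_norm.
rewrite mulrC ler_pdivrMr// mulrC -ler_pdivrMr//.
by apply/ltW/(lt_le_trans (truncnS_gt _)); rewrite ler_nat.
Qed.

End density_difference.

(** * Parametrized families of densities *)

Lemma ExpectE {R : realType} {dT} {T : measurableType dT} (P : probability T R)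
  (X : T -> R) : Expect P X = \int[P]_x X x.
Proof. by rewrite /Expect unlock. Qed.

Lemma derive_ln_comp {R : realType} (V : normedModType R) (f : V -> R) (x v : V) :
  differentiable f x -> 0 < f x -> 'D_v (fun y => ln (f y)) x = (f x)^-1 * 'D_v f x.
Proof.
move=> df fx; have dl := is_derive1_ln fx.
have dln : differentiable (@ln R) (f x) by apply/derivable1_diffP; case: dl.
rewrite deriveE; last exact: (differentiable_comp df dln).
rewrite -[(fun y => _)]/(@ln R \o f) (diff_comp df dln)/= -deriveE//.
(* The increment fed to the differential of [ln] is written as a multiple of 1, to bring out the
   derivative of [ln]. *)
rewrite -['d f x v](mulr1 ('d f x v : R)) -[_ * 1]/(('d f x v : R) *: (1 : R)).
by rewrite deriveZ_dir// derive_val mulrC deriveE.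
Qed.

Section family.
Context {R : realType} {m d : nat}.
Variables (mu : {sigma_finite_measure set (Rvec R d) -> \bar R}).
Variables (Z : set (Rvec R d)) (B : set 'rV[R]_m).
Variables (D : 'rV[R]_m -> probability (Rvec R d) R) (p : Rvec R d -> 'rV[R]_m -> R).
Hypothesis Dp : density_family mu Z B D p.
Implicit Types (b : 'rV[R]_m) (f g : Rvec R d -> R).

Let mp := density_measurable Dp.
Let p0 := density_ge0 Dp.
Let DE := densityE Dp.

Lemma posset_sub b z : B b -> posset p b z -> Z z.
Proof.
move=> Bb zp; apply: contrapT => Zz.
by move: zp; rewrite /posset/= (density_out Dp Bb Zz) ltxx.
Qed.

Lemma posset_out b z : B b -> ~ posset p b z -> p z b = 0.
Proof.
move=> Bb /negP; rewrite -leNgt => pz; apply/eqP.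
by rewrite eq_le pz p0.
Qed.

Lemma measurable_posset b : B b -> measurable (posset p b).
Proof.
move=> Bb; have -> : posset p b = setT `&` (p ^~ b) @^-1` `]0, +oo[%classic.
  by apply/seteqP; split => z; rewrite /posset/= in_itv/= andbT => // -[].
by apply: (mp Bb) => //; exact: measurable_itv.
Qed.

Lemma ge0_integral_family b (f : Rvec R d -> \bar R) : B b ->
  measurable_fun setT f -> (forall z, (0 <= f z)%E) ->
  (\int[D b]_z f z = \int[mu]_z (f z * (p z b)%:E))%E.
Proof.
move=> Bb mf f0.
by apply: ge0_integral_density => // [|z|A mA]; [exact: mp|exact: p0|exact: DE].
Qed.

Lemma integrable_family b f : B b -> measurable_fun setT f ->
  (D b).-integrable setT (EFin \o f) <->
  mu.-integrable setT (fun z => (f z * p z b)%:E).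
Proof.
move=> Bb mf.
by apply: integrable_density => // [|z|A mA]; [exact: mp|exact: p0|exact: DE].
Qed.

Lemma Rintegral_family b f : B b -> measurable_fun setT f ->
  (D b).-integrable setT (EFin \o f) ->
  \int[D b]_z f z = \int[mu]_z (f z * p z b).
Proof.
move=> Bb mf.
by apply: Rintegral_density => // [|z|A mA]; [exact: mp|exact: p0|exact: DE].
Qed.

(** The comparison is asked only where the density is positive, which is where the growth bounds can
    be applied; elsewhere the factor [p] vanishes. *)
Lemma ge0_le_integral_family b f g : B b ->
  measurable_fun setT f -> measurable_fun setT g ->
  (forall z, 0 <= f z) -> (forall z, 0 <= g z) ->
  (forall z, posset p b z -> f z <= g z) ->
  (\int[D b]_z (f z)%:E <= \int[D b]_z (g z)%:E)%E.
Proof.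
move=> Bb mf mg f0 g0 fg.
rewrite !ge0_integral_family//; try by apply/measurable_EFinP.
have mpE : measurable_fun setT (fun z => (p z b)%:E).
  by apply/measurable_EFinP; exact: mp.
apply: ge0_le_integral => //.
- by move=> z _; apply: mule_ge0; rewrite lee_fin ?f0// p0.
- by apply: emeasurable_funM => //; exact/measurable_EFinP.
- by apply: emeasurable_funM => //; exact/measurable_EFinP.
move=> z _; have [zp|zp] := pselect (posset p b z).
  by apply: lee_wpmul2r; rewrite lee_fin ?p0// fg.
by rewrite (posset_out Bb zp) !mule0.
Qed.

(** Passes from the integrals over the positivity set in [diff_under_integral] to integrals over the
    whole space. *)
Lemma Rintegral_posset b (f g : Rvec R d -> R) : B b ->
  (forall z, posset p b z -> f z = g z) ->
  (forall z, ~ posset p b z -> g z = 0) ->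
  \int[mu]_(z in posset p b) f z = \int[mu]_z g z.
Proof.
move=> Bb fg g0; rewrite Rintegral_mkcond; apply: eq_Rintegral => z _.
by rewrite patchE; case: ifPn => [/[!inE]/fg|/negP/[!inE]/g0].
Qed.

Variable qm : nat.
Variable M : nat -> R.
Hypothesis MD : forall k, (k <= qm)%N ->
  (ereal_sup [set 'E_(D b)[(fun z : Rvec R d => enorm (z : 'rV[R]_d) ^+ k)%R]
               | b in B] <= (M k)%:E)%E.

Lemma measurable_enormX k :
  measurable_fun setT (fun z : Rvec R d => enorm (z : 'rV[R]_d) ^+ k).
Proof.
by apply: measurable_funX; apply: measurable_fun_Rvec; exact: continuous_enorm.
Qed.

Lemma moment_le b k : B b -> (k <= qm)%N ->
  (\int[D b]_z (enorm (z : 'rV[R]_d) ^+ k)%:E <= (M k)%:E)%E.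
Proof.
move=> Bb kq; apply: le_trans (MD kq); rewrite -[leLHS]/(\int[D b]_z _)%E.
by apply: ereal_sup_ubound; exists b => //; rewrite unlock.
Qed.

Lemma poly_growth_integral_le b f (K : R) q : B b -> (q <= qm)%N -> 0 <= K ->
  measurable_fun setT f ->
  (forall z, posset p b z -> `|f z| <= K * (1 + enorm (z : 'rV[R]_d) ^+ q)) ->
  (\int[D b]_z `|f z|%:E <= (K * (1 + `|M q|))%:E)%E.
Proof.
move=> Bb qq K0 mf fK.
have mq := measurable_enormX q.
apply: (@le_trans _ _ (\int[D b]_z (K * (1 + enorm (z : 'rV[R]_d) ^+ q))%:E)%E).
  apply: ge0_le_integral_family => //.
  - exact: measurableT_comp.
  - by apply: measurable_funM => //; exact: measurable_funD.
  - by move=> z; rewrite mulr_ge0// addr_ge0// exprn_ge0// enorm_ge0.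
under eq_integral do rewrite EFinM EFinD.
have mqE : measurable_fun setT (fun z : Rvec R d => (enorm (z : 'rV[R]_d) ^+ q)%:E).
  exact/measurable_EFinP.
have q0 (z : 'rV[R]_d) : (0 <= (enorm z ^+ q)%:E)%E.
  by rewrite lee_fin exprn_ge0 ?enorm_ge0.
rewrite ge0_integralZl_EFin//; last 2 first.
- by move=> z _; rewrite adde_ge0.
- exact: emeasurable_funD.
rewrite EFinM lee_wpmul2l ?lee_fin// ge0_integralD//.
have D1 : (\int[D b]_(z in setT) 1 = 1)%E.
  by rewrite integral_cst// mul1e; exact: probability_setT.
rewrite D1 EFinD leeD2l//.
by apply: le_trans (moment_le Bb qq) _; rewrite lee_fin ler_norm.
Qed.

(** From (1 + y)^2 <= 2 (1 + y^2). The bound does not depend on [b] and is written as a square, the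
    form in which [integral_densityB_le] takes it; the absolute value is there because the sign of
    [M] is not assumed. *)
Lemma poly_growth_integral_sqr_le b f (K : R) q : B b -> (2 * q <= qm)%N -> 0 <= K ->
  measurable_fun setT f ->
  (forall z, posset p b z -> `|f z| <= K * (1 + enorm (z : 'rV[R]_d) ^+ q)) ->
  (\int[D b]_z (f z ^+ 2)%:E <=
    ((K * Num.sqrt (2 * (1 + `|M (2 * q)%N|))) ^+ 2)%:E)%E.
Proof.
move=> Bb qq K0 mf fK.
rewrite exprMn sqr_sqrtr ?mulr_ge0 ?addr_ge0// mulrA.
under eq_integral do rewrite -[_ ^+ 2]ger0_norm ?sqr_ge0//.
apply: poly_growth_integral_le => //.
- by rewrite mulr_ge0 ?sqr_ge0.
- exact: measurable_funX.
move=> z zp; rewrite normrX.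
apply: (@le_trans _ _ ((K * (1 + enorm (z : 'rV[R]_d) ^+ q)) ^+ 2)).
  rewrite ler_sqr ?nnegrE//; first exact: fK.
  by rewrite mulr_ge0// addr_ge0// exprn_ge0 ?enorm_ge0.
rewrite exprMn -[leRHS]mulrA; apply: ler_wpM2l; first exact: sqr_ge0.
rewrite mulnC exprM.
set y := enorm _ ^+ q; have := sqr_ge0 (1 - y); lra.
Qed.

Hypothesis reg_p : forall z, Z z ->
  exists U : set 'rV[R]_m, [/\ open U, B `<=` U & Cdiff 2 U (p z)].
Hypothesis reg_support : forall b b', B b -> B b' -> posset p b = posset p b'.
Hypothesis reg_int_p : diff_under_integral mu p B p.

Lemma differentiable_density b z : B b -> posset p b z -> differentiable (p z) b.
Proof.
move=> Bb /(posset_sub Bb)/reg_p[U [_ BU [dU _]]].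
exact/dU/BU.
Qed.

Lemma score_coord b z j : B b -> posset p b z ->
  score p z b 0 j = (p z b)^-1 * grad (p z) b 0 j.
Proof.
move=> Bb zp; rewrite /score ifT// !mxE derive_ln_comp//.
exact: differentiable_density.
Qed.

Lemma scoreE b z : B b -> posset p b z ->
  score p z b = (p z b)^-1 *: grad (p z) b.
Proof. by move=> Bb zp; apply/rowP => j; rewrite score_coord// !mxE. Qed.

Lemma score_out b z : ~ posset p b z -> score p z b = 0.
Proof. by move=> /negP zp; rewrite /score (negbTE zp). Qed.

Lemma derive_density b z v : B b -> posset p b z ->
  'D_v (p z) b = p z b * dotv (score p z b) v.
Proof.
move=> Bb zp; rewrite scoreE// dotvZl mulrA divff ?gt_eqF// mul1r dotv_grad//.
exact: differentiable_density.
Qed.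

(** On the positivity set the score is the gradient of the density divided by the density, and that
    gradient is measurable there because [diff_under_integral] makes it integrable. Elsewhere the
    score is 0. *)
Lemma measurable_score b j : B b ->
  measurable_fun setT (fun z => score p z b 0 j).
Proof.
move=> Bb; have mS := measurable_posset Bb.
rewrite (_ : (fun z => _) =
    (fun z => (p z b) `^ (-1) * grad (p z) b 0 j) \_ (posset p b)); last first.
  apply/funext => z; rewrite patchE; case: ifPn.
    rewrite inE => zp; rewrite score_coord// powR_inv1//; exact: ltW.
  by move=> /negP; rewrite inE => zp; rewrite score_out// mxE.
apply: (iffLR (measurable_restrictT _ mS)).
have m1 : measurable_fun setT (fun z => (p z b) `^ (-1)).
  exact: (measurableT_comp (measurable_powR _) (mp Bb)).
apply: measurable_funM; first exact: measurable_funTS m1.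
by have [_ /(_ j)/measurable_int/measurable_EFinP] := reg_int_p Bb.
Qed.

(** The support being common, either all densities vanish at [z], or [p z] is positive along the
    whole segment and its derivative there is [p] times the score. *)
Lemma density_path b b' z : B b -> B b' -> convex_set B ->
  exists M : R, forall N : nat,
  `|p z b' - p z b| <= N.+1%:R^-1 * (\sum_(k < N.+1)
    `|p z (b + (k%:R / N.+1%:R) *: (b' - b)) *
      dotv (score p z (b + (k%:R / N.+1%:R) *: (b' - b))) (b' - b)| + M).
Proof.
move=> Bb Bb' cB.
have Bs s : 0 <= s <= 1 -> B (b + s *: (b' - b)) by exact: convex_set_segment.
have Bk N (k : 'I_N.+1) : B (b + (k%:R / N.+1%:R) *: (b' - b)).
  by apply: Bs; rewrite divr_ge0//= ler_pdivrMr// mul1r ler_nat ltnW.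
have [zp|zp] := pselect (posset p b z); last first.
  exists 0 => N; rewrite posset_out//; last by rewrite (reg_support Bb' Bb).
  rewrite posset_out// subrr normr0 mulr_ge0 ?invr_ge0// addr0.
  by apply: sumr_ge0 => k _.
have [U [_ BU dU]] := reg_p (posset_sub Bb zp).
have [M' M'0 HM] := increment_le_Riemann dU (fun s s01 => BU _ (Bs s s01)).
exists M' => N; move: (HM N); rewrite [b + (b' - b)]addrC subrK => /le_trans; apply.
rewrite ler_wpM2l ?invr_ge0// lerD2r; apply: ler_sum => k _.
by rewrite derive_density// (reg_support (Bk _ _) Bb).
Qed.

Variables (q1 : nat) (K1 J : R).
Hypotheses (q1m : (2 * q1 <= qm)%N) (K10 : 0 <= K1)
  (sK1 : forall z b, B b -> posset p b z ->
    enorm (score p z b) <= K1 * (1 + enorm (z : 'rV[R]_d) ^+ q1))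
  (fJ : forall b, B b -> \tr (fisher D p b) <= J).

(** The trace of the Fisher information is E|s|^2, provided the diagonal entries are finite:
    [Expect] would send an infinite expectation to 0. Growth of the score and moments of order 2 q1
    settle this first. *)
Lemma integral_score_sqr_le b : B b ->
  (\int[D b]_z (enorm (score p z b) ^+ 2)%:E <= J%:E)%E.
Proof.
move=> Bb; have ms := measurable_score.
have me : measurable_fun setT (fun z => enorm (score p z b)).
  by apply: measurable_fun_enorm => j; exact: ms.
have mss j : measurable_fun setT (fun z => score p z b 0 j * score p z b 0 j).
  by apply: measurable_funM; exact: ms.
have iss j : (D b).-integrable setT (fun z => (score p z b 0 j * score p z b 0 j)%:E).
  apply/integrableP; split; first exact/measurable_EFinP.
  apply: (@le_lt_trans _ _ (\int[D b]_z (enorm (score p z b) ^+ 2)%:E)%E).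
    apply: ge0_le_integral => //.
    - by apply/measurable_EFinP; exact: measurableT_comp.
    - by apply/measurable_EFinP; exact: measurable_funX.
    - move=> z _; rewrite abse_EFin lee_fin -expr2 normrX.
      by rewrite ler_sqr ?nnegrE ?enorm_ge0// enorm_coord.
  apply: le_lt_trans (poly_growth_integral_sqr_le Bb q1m K10 me _) _ => //.
    by move=> z zp; rewrite ger0_norm ?enorm_ge0// sK1.
  by rewrite ltry.
under eq_integral do rewrite enorm_sqr /dotv -sumEFin.
rewrite integral_sum//; apply: (@le_trans _ _ (\tr (fisher D p b))%:E); last first.
  by rewrite lee_fin fJ.
rewrite /mxtrace -sumEFin le_eqVlt; apply/orP; left; apply/eqP.
apply: eq_bigr => j _; rewrite mxE ExpectE /Rintegral fineK//.
exact: integrable_fin_num.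
Qed.

Hypothesis cB : convex_set B.
Hypothesis J0 : 0 <= J.

Lemma integral_densityB_le f (L : R) b b' : measurable_fun setT f ->
  (forall z, 0 <= f z) -> 0 <= L ->
  (forall c, B c -> (\int[D c]_z (f z ^+ 2)%:E <= (L ^+ 2)%:E)%E) ->
  B b -> B b' ->
  (\int[mu]_z (f z * `|p z b' - p z b|)%:E <=
    (L * Num.sqrt J * enorm (b' - b))%:E)%E.
Proof.
move=> mf f0 L0 fL Bb Bb'.
apply: (@integral_density_difference_le _ _ _ _ mu B p D (score p)) => //.
- by move=> c j Bc; exact: measurable_score.
- exact: integral_score_sqr_le.
- by move=> c c' z Bc Bc'; exact: density_path.
Qed.

End family.

(** * Jacobians on a convex domain *)

Section convex_domain.
Context {R : realType} {n m : nat}.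
Implicit Types (Theta : set 'rV[R]_n) (t : 'rV[R]_n).

(** t0 + v is the barycenter of the n points t0 + n v_i e_i, each on the segment between t0 - delta
    e_i and t0 + delta e_i since n |v_i| <= delta. *)
Lemma Theta_delta_ball Theta (delta : R) t0 : (0 < n)%N -> 0 < delta ->
  convex_set Theta -> Theta_delta Theta delta t0 ->
  forall v : 'rV[R]_n, n%:R * enorm v <= delta -> Theta (t0 + v).
Proof.
move=> n0 d0 cT [Tt0 Td] v vd.
have n0R : 0 < n%:R :> R by rewrite ltr0n.
have Ti (i : 'I_n) : Theta (t0 + (n%:R * v 0 i) *: delta_mx 0 i).
  have [Tp Tm] := Td i.
  set a := n%:R * v 0 i.
  have : `|a| <= delta.
    rewrite normrM ger0_norm//; apply: le_trans vd.
    by rewrite ler_wpM2l// enorm_coord.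
  rewrite ler_norml => /andP[a1 a2].
  (* The position of t0 + a e_i on the segment from t0 - delta e_i to t0 + delta e_i. *)
  have /(convex_set_segment cT Tm Tp) : 0 <= (a + delta) / (2 * delta) <= 1.
    rewrite divr_ge0 ?mulr_ge0 ?(ltW d0)//; last lra.
    by rewrite ler_pdivrMr ?mulr_gt0//; lra.
  congr (Theta _).
  have -> : t0 + delta *: delta_mx 0 i - (t0 - delta *: delta_mx 0 i) =
      (2 * delta) *: delta_mx 0 i.
    by rewrite opprB addrAC addrCA subrr addr0 -scalerDl mulr2n mulrDl mul1r.
  rewrite scalerA mulfVK ?mulf_neq0 ?gt_eqF//.
  by rewrite scalerDl addrA (addrAC t0) subrK.
have := convex_set_barycenter n0 cT Ti; congr (Theta _).
rewrite big_split/= sumr_const card_ord scalerDr -[t0 *+ n]scaler_nat.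
rewrite scalerA mulVf ?gt_eqF//.
rewrite scale1r scaler_sumr; congr (_ + _); rewrite [RHS]row_sum_delta.
by apply: eq_bigr => i _; rewrite scalerA mulrA mulVf ?gt_eqF// mul1r.
Qed.

Variables (Theta : set 'rV[R]_n) (beta : 'rV[R]_n -> 'rV[R]_m) (t0 : 'rV[R]_n) (r : R).
Hypotheses (cT : convex_set Theta) (r0 : 0 < r)
  (ballT : forall v : 'rV[R]_n, enorm v <= r -> Theta (t0 + v))
  (dbeta : forall t, Theta t -> differentiable beta t).

(** At a boundary point [t] some directions leave [Theta]. Moving [t] slightly towards [t0] makes
    every direction available, and [lipJ] says that the Jacobian changes little. *)
Lemma opnorm_jacobian_le (L K : R) : 0 <= L -> 0 <= K ->
  (forall t t', Theta t -> Theta t' ->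
    enorm (beta t - beta t') <= L * enorm (t - t')) ->
  (forall t t', Theta t -> Theta t' ->
    opnorm ('J beta t - 'J beta t') <= K * enorm (t - t')) ->
  forall t, Theta t -> opnorm ('J beta t) <= L.
Proof.
move=> L0 K0 lip lipJ.
have dir t w : Theta t -> Theta (t + w) -> enorm (w *m 'J beta t) <= L * enorm w.
  move=> Tt Tw; apply/ler_addgt0Pr => e e0.
  have [h /andP[h0 h1] H] := differentiable_direction w (dbeta Tt) e0.
  have Th : Theta (t + h *: w).
    have -> : w = t + w - t by rewrite addrC addKr.
    by apply: convex_set_segment => //; rewrite (ltW h0).
  have Hh : enorm (h^-1 *: (beta (t + h *: w) - beta t)) <= L * enorm w.
    rewrite enormZ gtr0_norm ?invr_gt0// mulrC ler_pdivrMr//.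
    apply: le_trans (lip _ _ Th Tt) _.
    rewrite [t + _]addrC addrK enormZ gtr0_norm//; lra.
  have := ler_enormD (h^-1 *: (beta (t + h *: w) - beta t))
    (- (h^-1 *: (beta (t + h *: w) - beta t) - w *m 'J beta t)).
  rewrite opprB addrC subrK enormBC; lra.
move=> t Tt; apply: opnorm_le => // v; apply/ler_addgt0Pr => e e0.
have Tt0 : Theta t0 by rewrite -[t0]addr0; apply: ballT; rewrite enorm0 ltW.
(* Replacing [t] by t + a (t0 - t) costs at most a K |t0 - t| |v| <= a C <= e. *)
pose C := K * enorm (t0 - t) * enorm v + 1.
have C0 : 0 < C by rewrite ltr_wpDl// !mulr_ge0 ?enorm_ge0.
pose a := Num.min 1 (e / C).
have a0 : 0 < a by rewrite lt_min ltr01 divr_gt0.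
have a1 : a <= 1 by rewrite ge_min lexx.
have ae : a * C <= e by rewrite -ler_pdivlMr// ge_min lexx orbT.
have Ta : Theta (t + a *: (t0 - t)) by apply: convex_set_segment; rewrite ?(ltW a0).
set ta := t + _ in Ta.
have v1 : 0 < enorm v + 1 by rewrite ltr_wpDl ?enorm_ge0.
pose c := r / (enorm v + 1).
have c0 : 0 < c by rewrite divr_gt0.
have cv : enorm (c *: v) <= r.
  rewrite enormZ gtr0_norm// /c mulrAC ler_pdivrMr// ler_wpM2l ?(ltW r0)//.
  by rewrite lerDl.
(* This point is on the segment from [t] to t0 + c v, which belongs to the ball. *)
have Taw : Theta (ta + (a * c) *: v).
  have -> : ta + (a * c) *: v = t + a *: (t0 + c *: v - t).
    by rewrite /ta -scalerA -addrA -scalerDr addrAC.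
  by apply: convex_set_segment => //; [exact: ballT|rewrite (ltW a0)].
have ac0 : 0 < a * c by rewrite mulr_gt0.
have := dir _ _ Ta Taw; rewrite -scalemxAl !enormZ gtr0_norm//.
rewrite (mulrCA L) ler_pM2l// => vta.
have -> : v *m 'J beta t = v *m 'J beta ta + v *m ('J beta t - 'J beta ta).
  by rewrite -mulmxDr addrC subrK.
apply: le_trans (ler_enormD _ _) _; apply: lerD => //.
apply: le_trans (enorm_mulmx _ _) _.
have := lipJ _ _ Tt Ta; rewrite /ta opprD addNKr enormN enormZ gtr0_norm// => H.
apply: le_trans (ler_wpM2r (enorm_ge0 v) H) _; apply: le_trans ae.
by rewrite /C mulrDr mulr1 -[leLHS]addr0 lerD ?(ltW a0)// !mulrA [K * a]mulrC.
Qed.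

(** First-order expansions make [w] orthogonal to (t' - t) J for all t' in [Theta]. Differences of
    such directions contain a ball, so u = w J^T can be tested against a multiple of itself. *)
Lemma mul_jacobian_eq0 (w : 'rV[R]_m) :
  (forall t t', Theta t -> Theta t' -> dotv w (beta t - beta t') = 0) ->
  forall t, Theta t -> w *m ('J beta t)^T = 0.
Proof.
move=> w0 t Tt.
have dir t' : Theta t' -> dotv w ((t' - t) *m 'J beta t) = 0.
  move=> Tt'; apply/eqP; rewrite -normr_le0; apply/ler_addgt0Pr => e e0.
  have w1 : 0 < enorm w + 1 by rewrite ltr_wpDl ?enorm_ge0.
  have e'0 : 0 < e / (enorm w + 1) by rewrite divr_gt0.
  have [h /andP[h0 h1] H] := differentiable_direction (t' - t) (dbeta Tt) e'0.
  have Th : Theta (t + h *: (t' - t)) by apply: convex_set_segment; rewrite ?(ltW h0).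
  rewrite add0r; set x := _ *m _ in H *.
  set y := h^-1 *: _ in H; have wy : dotv w y = 0 by rewrite dotvZr w0// mulr0.
  have -> : dotv w x = - dotv w (y - x) by rewrite dotvBr wy add0r opprK.
  rewrite normrN; apply: le_trans (CauchySchwarz_dotv _ _) _.
  apply: le_trans (ler_wpM2l (enorm_ge0 w) H) _.
  rewrite mulrCA ger_pMr// ler_pdivrMr// mul1r lerDl//.
apply: enorm_eq0; set u := w *m _.
have [//|u0] := eqVneq (enorm u) 0.
have up : 0 < enorm u by rewrite lt_def u0 enorm_ge0.
pose c := r / enorm u.
have c0 : 0 < c by rewrite divr_gt0.
have T1 : Theta (t0 + c *: u).
  by apply: ballT; rewrite enormZ gtr0_norm// /c divfK.
have T0 : Theta t0 by rewrite -[t0]addr0; apply: ballT; rewrite enorm0 ltW.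
have : dotv w ((c *: u) *m 'J beta t) = 0.
  have -> : c *: u = (t0 + c *: u - t) - (t0 - t).
    by rewrite opprB addrA subrK addrC addKr.
  by rewrite mulmxBl dotvBr !dir// subrr.
rewrite -dotv_mulmx -/u dotvZr -enorm_sqr => /eqP.
by rewrite mulf_eq0 gt_eqF//= sqrf_eq0 => /eqP.
Qed.

End convex_domain.

(** A gradient relative to [A] is seen only through the directions of [A]: constancy yields
    orthogonality to these, not that the gradient is 0. *)
Lemma has_grad_within_cst {R : realType} k (A : set 'rV[R]_k) (f : 'rV[R]_k -> R)
    (x y g : 'rV[R]_k) (c : R) : convex_set A -> (forall z, A z -> f z = c) ->
  has_grad_within A f x g -> A x -> A y -> dotv g (y - x) = 0.
Proof.
move=> cA fc fg Ax Ay; apply/eqP; rewrite -normr_le0; apply/ler_addgt0Pr => e e0.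
have y1 : 0 < enorm (y - x) + 1 by rewrite ltr_wpDl ?enorm_ge0.
have e'0 : 0 < e / (enorm (y - x) + 1) by rewrite divr_gt0.
have /nbhs_normP[/= r r0 H] := fg _ e'0.
pose h := Num.min 1 (r / (2 * (`|y - x| + 1))).
have v1 : 0 < `|y - x| + 1 by rewrite ltr_wpDl.
have h0 : 0 < h by rewrite lt_min ltr01/= divr_gt0// mulr_gt0.
have h1 : h <= 1 by rewrite ge_min lexx.
have hv : `|h *: (y - x)| < r.
  rewrite normrZ gtr0_norm//.
  have : h <= r / (2 * (`|y - x| + 1)) by rewrite ge_min lexx orbT.
  rewrite ler_pdivlMr ?mulr_gt0// => hr.
  have := normr_ge0 (y - x); move: hr; set a := `|y - x|; nra.
have Ah : A (x + h *: (y - x)) by apply: convex_set_segment; rewrite ?(ltW h0).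
have /H/(_ Ah) : ball_ Num.Def.normr x r (x + h *: (y - x)).
  by rewrite /ball_/= opprD addNKr normrN.
rewrite !fc// subrr sub0r normrN [x + _ - x]addrC addKr dotvZr enormZ normrM.
rewrite gtr0_norm// mulrCA ler_pM2l// add0r => /le_trans; apply.
by rewrite mulrAC ler_pdivrMr// ler_wpM2l ?(ltW e0)// lerDl.
Qed.

(** * Regularity and measurability of the loss *)

Section loss.
Context {R : realType} {d n : nat}.
Variable ell : Rvec R d -> 'rV[R]_n -> R.
Hypothesis Cell : Cdiff 2 setT (fun x : 'rV[R]_d * 'rV[R]_n => ell x.1 x.2).

Lemma differentiable_loss z t : differentiable (ell z) t.
Proof.
exact: (@differentiable_partial _ _ _ (fun x => ell x.1 x.2) z t (Cell.1 (z, t) I)).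
Qed.

Lemma grad_lossE z t j : grad (ell z) t 0 j =
  'D_(0, delta_mx 0 j) (fun x : 'rV[R]_d * 'rV[R]_n => ell x.1 x.2) (z, t).
Proof. by rewrite mxE -derive_partial. Qed.

Lemma differentiable_grad_loss z t : differentiable (grad (ell z)) t.
Proof.
apply: differentiable_row => j.
under eq_fun do rewrite grad_lossE.
apply: (@differentiable_partial _ _ _
  ('D_(0, delta_mx 0 j) (fun x : 'rV[R]_d * 'rV[R]_n => ell x.1 x.2)) z t).
by have [_ /(_ (0, delta_mx 0 j))[dD _]] := Cell; exact: dD.
Qed.

Lemma measurable_loss t : measurable_fun setT (fun z => ell z t).
Proof.
apply: measurable_fun_Rvec.
apply: (@continuous_partial _ _ _ (fun x => ell x.1 x.2) t) => z.
by apply/differentiable_continuous/(Cell.1 (z, t) I).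
Qed.

Lemma measurable_grad_loss t j : measurable_fun setT (fun z => grad (ell z) t 0 j).
Proof.
under eq_fun do rewrite grad_lossE.
apply: measurable_fun_Rvec.
apply: (@continuous_partial _ _ _
  ('D_(0, delta_mx 0 j) (fun x : 'rV[R]_d * 'rV[R]_n => ell x.1 x.2)) t) => z.
have [_ /(_ (0, delta_mx 0 j))[dD _]] := Cell.
exact/differentiable_continuous/dD.
Qed.

End loss.

(** * The performative loss *)

Lemma ge0_integral_le_sqr {R : realType} {dT} {T : measurableType dT}
    (P : probability T R) (f : T -> R) (c : R) :
  measurable_fun setT f -> (forall x, 0 <= f x) -> 0 <= c ->
  (\int[P]_x (f x ^+ 2)%:E <= (c ^+ 2)%:E)%E -> (\int[P]_x (f x)%:E <= c%:E)%E.
Proof.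
move=> mf f0 c0 fc; rewrite -[c]mulr1; under eq_integral do rewrite -[f _]mulr1.
apply: integral_CauchySchwarz => //.
under eq_integral do rewrite expr1n.
by rewrite integral_cst// mul1e expr1n probability_le1.
Qed.

Lemma integrable_le_fin {R : realType} {dT} {T : measurableType dT}
    (P : {measure set T -> \bar R}) (f : T -> R) (c : R) :
  measurable_fun setT f -> (\int[P]_x `|f x|%:E <= c%:E)%E ->
  P.-integrable setT (fun x => (f x)%:E).
Proof.
move=> mf fc; apply/integrableP; split; first exact/measurable_EFinP.
by apply: le_lt_trans fc _; rewrite ltry.
Qed.

(** Bookkeeping for the shares of epsilon in [perf_loss_has_grad]; dividing by a + 1 avoids the case
    a = 0. *)
Lemma ler_frac_addr1 {R : realFieldType} (a e c : R) :
  0 <= a -> 0 <= e -> 0 < c -> a * (e / (c * (a + 1))) <= e / c.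
Proof.
move=> a0 e0 c0; have a1 : 0 < a + 1 by rewrite ltr_wpDl.
rewrite mulrA ler_pdivrMr ?mulr_gt0// mulrA divfK ?gt_eqF// mulrC.
by rewrite ler_wpM2l// lerDl.
Qed.

Lemma normr_Rintegral_le {R : realType} {dT} {T : measurableType dT}
    (P : {measure set T -> \bar R}) (f : T -> R) (c : R) :
  measurable_fun setT f -> (\int[P]_x `|f x|%:E <= c%:E)%E ->
  `|\int[P]_x f x| <= c.
Proof.
move=> mf fc; have fi := integrable_le_fin mf fc.
apply: le_trans (le_normr_Rintegral measurableT fi) _.
rewrite -lee_fin fineK// ge0_fin_numE ?integral_ge0//.
by apply: le_lt_trans fc _; rewrite ltry.
Qed.

Section performative_loss.
Context {R : realType} {n m d : nat}.
Variables (Theta : set 'rV[R]_n) (delta : R).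
Variables (B : set 'rV[R]_m) (beta : 'rV[R]_n -> 'rV[R]_m).
Variables (Z : set (Rvec R d)) (ell : Rvec R d -> 'rV[R]_n -> R).
Variables (mu : {sigma_finite_measure set (Rvec R d) -> \bar R}).
Variables (D : 'rV[R]_m -> probability (Rvec R d) R) (p : Rvec R d -> 'rV[R]_m -> R).
Variables (Pred : forall k, k.-tuple (Rvec R d) -> 'rV[R]_m) (q1 q2 q3 q4 q5 : nat).
Variables (Lell_lip Lell_sm Lbeta_lip Lbeta_sm LG_beta LG_theta Mell Imax : R).
Hypotheses (n0 : (0 < n)%N) (delta0 : 0 < delta).
Hypothesis Dp : density_family mu Z B D p.
Hypothesis A : regularity Theta delta B beta Z ell mu D p Pred q1 q2 q3 q4 q5.
Hypothesis C : smoothness_constants Theta B beta ell D p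
  Lell_lip Lell_sm Lbeta_lip Lbeta_sm LG_beta LG_theta Mell Imax.
Implicit Types (t : 'rV[R]_n) (b : 'rV[R]_m).

Let cT : convex_set Theta. Proof. by case: (reg_Theta A). Qed.
Let cB : convex_set B. Proof. by case: (reg_B A). Qed.
Let bB t : Theta t -> B (beta t).
Proof. by move=> Tt; case: (reg_B A) => _ _; apply; exists t. Qed.
Let Lell_lip0 : 0 <= Lell_lip. Proof. by case: (cst_ge0 C) => -[]. Qed.
Let Lbeta_lip0 : 0 <= Lbeta_lip. Proof. by case: (cst_ge0 C) => -[]. Qed.
Let Lbeta_sm0 : 0 <= Lbeta_sm. Proof. by case: (cst_ge0 C) => -[]. Qed.
Let Mell0 : 0 <= Mell. Proof. by case: (cst_ge0 C) => _ []. Qed.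
Let Imax0 : 0 <= Imax. Proof. by case: (cst_ge0 C) => _ []. Qed.

Let le_q_max q : q \in [:: 2 * q1 + q3; q2 + q3; 2 * q3; 2 * q4; q1 + q4; q5]%N ->
  (q <= q_max q1 q2 q3 q4 q5)%N.
Proof. by move=> qs; rewrite /q_max; exact: leq_bigmax_seq. Qed.

Let dbeta t : differentiable beta t.
Proof. exact: (reg_beta A).1. Qed.

Let mell t : measurable_fun setT (fun z => ell z t).
Proof. exact: measurable_loss (reg_ell A) t. Qed.

Let mgrad t j : measurable_fun setT (fun z => grad (ell z) t 0 j).
Proof. exact: measurable_grad_loss (reg_ell A) t j. Qed.

Let mscore b j : B b -> measurable_fun setT (fun z => score p z b 0 j).
Proof. exact: (measurable_score Dp (reg_p A) (reg_int_p A)). Qed.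

Let menorm_score b : B b -> measurable_fun setT (fun z => enorm (score p z b)).
Proof. by move=> Bb; apply: measurable_fun_enorm => j; exact: mscore. Qed.

Let menorm_grad t : measurable_fun setT (fun z => enorm (grad (ell z) t)).
Proof. by apply: measurable_fun_enorm => j; exact: mgrad. Qed.

Let q1_le : (2 * q1 <= q_max q1 q2 q3 q4 q5)%N.
Proof. by apply: leq_trans (leq_addr q3 _) _; apply: le_q_max; rewrite !inE eqxx. Qed.

Lemma score_sqr_le b : B b ->
  (\int[D b]_z (enorm (score p z b) ^+ 2)%:E <= Imax%:E)%E.
Proof.
move=> Bb; have [M HM] := reg_moments A; have [K1 K10 HK1] := reg_score A.
exact: (integral_score_sqr_le Dp HM (reg_p A) (reg_int_p A) q1_le K10 HK1 (cst_fisher C)).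
Qed.

Lemma densityB_le (f : Rvec R d -> R) (L : R) b b' : measurable_fun setT f ->
  (forall z, 0 <= f z) -> 0 <= L ->
  (forall c, B c -> (\int[D c]_z (f z ^+ 2)%:E <= (L ^+ 2)%:E)%E) ->
  B b -> B b' ->
  (\int[mu]_z (f z * `|p z b' - p z b|)%:E <=
    (L * Num.sqrt Imax * enorm (b' - b))%:E)%E.
Proof.
have [M HM] := reg_moments A; have [K1 K10 HK1] := reg_score A.
exact: (integral_densityB_le Dp HM (reg_p A) (reg_support A) (reg_int_p A)
  q1_le K10 HK1 (cst_fisher C) cB Imax0).
Qed.

(** * First part of the gradient *)

Lemma grad_loss_sqr_le t b : Theta t -> B b ->
  (\int[D b]_z (enorm (grad (ell z) t) ^+ 2)%:E <= (Lell_lip ^+ 2)%:E)%E.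
Proof.
move=> Tt Bb.
have H : ('E_(D b)[(fun z => enorm (grad (ell z) t) ^+ 2)%R] `^ (2^-1)%R
    <= Lell_lip%:E)%E.
  by apply: le_trans (cst_ell_lip C Tt); apply: ereal_sup_ubound; exists b.
move: H; rewrite unlock.
have : (0 <= \int[D b]_z (enorm (grad (ell z) t) ^+ 2)%:E)%E.
  by apply: integral_ge0 => z _; rewrite lee_fin sqr_ge0.
case: (\int[D b]_z _)%E => [r| |]// r0; rewrite poweR12_sqrt//.
rewrite !lee_fin => H; rewrite -(sqr_sqrtr r0).
by rewrite ler_sqr ?nnegrE ?sqrtr_ge0.
Qed.

Lemma integrable_grad_loss t b j : Theta t -> B b ->
  (D b).-integrable setT (fun z => (grad (ell z) t 0 j)%:E).
Proof.
move=> Tt Bb; apply: (enorm_integrable (c := Lell_lip) (mgrad t)).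
apply: ge0_integral_le_sqr => //; first by move=> z; exact: enorm_ge0.
exact: grad_loss_sqr_le.
Qed.

Lemma perf_grad1_lip t t' : Theta t -> Theta t' ->
  enorm (perf_grad1 beta ell D t - perf_grad1 beta ell D t') <=
  (Lell_sm + Lell_lip * Lbeta_lip * Num.sqrt Imax) * enorm (t - t').
Proof.
move=> Tt Tt'; have Bt := bB Tt; have Bt' := bB Tt'.
have iE := integrable_family Dp Bt; have iE' := integrable_family Dp Bt'.
(* First change the argument of the loss under a fixed law, which costs [Lell_sm]; then change the
   law under a fixed loss gradient, which [densityB_le] bounds with L = [Lell_lip]. *)
have -> : perf_grad1 beta ell D t - perf_grad1 beta ell D t' =
    \row_j (\int[D (beta t)]_z (grad (ell z) t - grad (ell z) t') 0 j) +
    \row_j (\int[mu]_z ((p z (beta t) - p z (beta t')) *: grad (ell z) t') 0 j).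
  apply/rowP => j; rewrite !mxE !ExpectE.
  have i1 := integrable_grad_loss j Tt Bt.
  have i2 := integrable_grad_loss j Tt' Bt.
  have i3 := integrable_grad_loss j Tt' Bt'.
  under [X in _ = X + _]eq_Rintegral do rewrite rowB.
  under [X in _ = _ + X]eq_Rintegral do rewrite rowZ mulrBl !(mulrC (p _ _)).
  rewrite RintegralB// RintegralB//; last 2 first.
  - exact: (iffLR (iE _ (mgrad t' j)) i2).
  - exact: (iffLR (iE' _ (mgrad t' j)) i3).
  rewrite -(Rintegral_family Dp Bt (mgrad t' j) i2).
  by rewrite -(Rintegral_family Dp Bt' (mgrad t' j) i3) addrA subrK.
apply: le_trans (ler_enormD _ _) _; rewrite mulrDl; apply: lerD.
  apply: enorm_Rintegral_le => [j|].
    by under eq_fun do rewrite rowB; apply: measurable_funB.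
  by have := cst_ell_sm C Tt Tt'; rewrite unlock.
apply: (@le_trans _ _ (Lell_lip * Num.sqrt Imax * enorm (beta t - beta t'))).
  apply: enorm_Rintegral_le => [j|].
    under eq_fun do rewrite rowZ; apply: measurable_funM => //.
    by apply: measurable_funB; apply: (density_measurable Dp).
  under eq_integral do rewrite enormZ mulrC.
  apply: densityB_le => //; first by move=> z; exact: enorm_ge0.
  by move=> c Bc; exact: grad_loss_sqr_le.
have := cst_beta_lip C Tt Tt' => H.
rewrite [leRHS](_ : _ = Lell_lip * Num.sqrt Imax * (Lbeta_lip * enorm (t - t'))).
  by apply: ler_wpM2l => //; rewrite mulr_ge0 ?sqrtr_ge0.
by ring.
Qed.

(** * Second part of the gradient *)

Let mean_score b : 'rV[R]_m := \row_j Expect (D b) (fun z => score p z b 0 j).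

Lemma enorm_score_le b : B b ->
  (\int[D b]_z (enorm (score p z b))%:E <= (Num.sqrt Imax)%:E)%E.
Proof.
move=> Bb; apply: ge0_integral_le_sqr => //.
- exact: menorm_score.
- by move=> z; exact: enorm_ge0.
- by rewrite sqr_sqrtr// score_sqr_le.
Qed.

Lemma integrable_score b j : B b ->
  (D b).-integrable setT (fun z => (score p z b 0 j)%:E).
Proof.
move=> Bb; apply: (enorm_integrable _ (enorm_score_le Bb)) => i.
exact: mscore.
Qed.

(** The total mass is constantly 1 on [B], and differentiating it under the integral gives the mean
    score as a gradient relative to [B]. *)
Lemma dotv_mean_score b b' : B b -> B b' -> dotv (mean_score b) (b' - b) = 0.
Proof.
move=> Bb Bb'; have [_ _] := reg_int_p A Bb.
have -> : \row_j (\int[mu]_(z in posset p b) grad (p z) b 0 j) = mean_score b.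
  apply/rowP => j; rewrite !mxE ExpectE.
  rewrite (Rintegral_family Dp Bb (mscore j Bb) (integrable_score j Bb)).
  apply: (Rintegral_posset mu Bb) => z zp.
    by rewrite (score_coord Dp (reg_p A) j Bb zp) mulrAC mulVf ?mul1r// gt_eqF.
  by rewrite (posset_out Dp Bb zp) mulr0.
move=> H; apply: (has_grad_within_cst (c := 1) cB _ H) => // c Bc.
rewrite (Rintegral_posset mu (g := fun z => p z c) Bb)//.
  by rewrite /Rintegral -(densityE Dp Bc measurableT) probability_setT.
by move=> z; rewrite (reg_support A Bb Bc); exact: (posset_out Dp Bc).
Qed.

Lemma loss_sqr_le t b : Theta t -> B b -> exists2 c : R, 0 <= c &
  (\int[D b]_z (ell z t ^+ 2)%:E <= (c ^+ 2)%:E)%E.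
Proof.
move=> Tt Bb; have [M HM] := reg_moments A; have [K3 K30 HK3] := reg_ell0 A.
eexists; last first.
  apply: (poly_growth_integral_sqr_le Dp HM (q := q3) (K := K3) Bb) => //.
    by apply: le_q_max; rewrite !inE eqxx ?orbT.
  by move=> z zp; apply: HK3 => //; exact: posset_sub Dp _ _ Bb zp.
by rewrite mulr_ge0 ?sqrtr_ge0.
Qed.

Lemma integrable_loss t b : Theta t -> B b ->
  (D b).-integrable setT (fun z => (ell z t)%:E).
Proof.
move=> Tt Bb; have [c c0 lc] := loss_sqr_le Tt Bb.
apply: (@integrable_le_fin _ _ _ _ _ c) => //.
apply: ge0_integral_le_sqr => //; first exact: measurableT_comp.
by under eq_integral do rewrite real_normK ?num_real//.
Qed.

Lemma integrable_loss_score t b j : Theta t -> B b ->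
  (D b).-integrable setT (fun z => (ell z t * score p z b 0 j)%:E).
Proof.
move=> Tt Bb; have [c c0 lc] := loss_sqr_le Tt Bb.
have ml : measurable_fun setT (fun z => `|ell z t|) by exact: measurableT_comp.
apply: (@integrable_le_fin _ _ _ _ _ (c * Num.sqrt Imax)).
  by apply: measurable_funM => //; exact: mscore.
apply: (@le_trans _ _ (\int[D b]_z (`|ell z t| * enorm (score p z b))%:E)%E).
  apply: ge0_le_integral => //.
  - apply/measurable_EFinP; apply: measurableT_comp => //.
    by apply: measurable_funM => //; exact: mscore.
  - apply/measurable_EFinP; apply: measurable_funM => //; exact: menorm_score.
  - by move=> z _; rewrite lee_fin normrM ler_wpM2l// enorm_coord.
apply: integral_CauchySchwarz => //.
- exact: menorm_score.
- by move=> z; exact: enorm_ge0.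
- by under eq_integral do rewrite real_normK ?num_real//.
- by rewrite sqr_sqrtr// score_sqr_le.
Qed.

(* Centering the loss changes [G] by a multiple of the mean score only. *)
Lemma enorm_centered_Gvec_le t b : Theta t -> B b ->
  enorm (Gvec ell D p t b - Expect (D b) (fun z => ell z t) *: mean_score b) <=
  Num.sqrt (Mell * Imax).
Proof.
move=> Tt Bb; set c := Expect _ _.
have -> : Gvec ell D p t b - c *: mean_score b =
    \row_j \int[D b]_z ((ell z t - c) *: score p z b) 0 j.
  apply/rowP => j; rewrite !mxE !ExpectE.
  under [RHS]eq_Rintegral do rewrite rowZ mulrBl.
  rewrite RintegralB// ?RintegralZl//; first exact: integrable_score.
  - exact: integrable_loss_score.
  - exact: (integrableZl measurableT c (integrable_score j Bb)).
have mc : measurable_fun setT (fun z => `|ell z t - c|).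
  by apply: measurableT_comp => //; exact: measurable_funB.
apply: enorm_Rintegral_le => [j|].
  under eq_fun do rewrite rowZ; apply: measurable_funM; last exact: mscore.
  exact: measurable_funB.
under eq_integral do rewrite enormZ.
rewrite sqrtrM//; apply: integral_CauchySchwarz => //.
- exact: menorm_score.
- by move=> z; exact: enorm_ge0.
- rewrite sqr_sqrtr//; apply: le_trans (cst_var C Tt Bb).
  rewrite /variance covariance.unlock expectation.unlock le_eqVlt.
  apply/orP; left; apply/eqP; apply: eq_integral => z _.
  by rewrite real_normK ?num_real// /c /Expect expectation.unlock expr2.
- by rewrite sqr_sqrtr// score_sqr_le.
Qed.

Let ball_Theta : exists t0 r, [/\ 0 < r :> R &
  forall v : 'rV[R]_n, enorm v <= r -> Theta (t0 + v)].
Proof.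
have [[t0 Tt0] _ _ _] := reg_Theta_delta A.
have n0R : 0 < n%:R :> R by rewrite ltr0n.
exists t0, (delta / n%:R); split; first by rewrite divr_gt0.
move=> v; rewrite ler_pdivlMr// mulrC => vd.
exact: (Theta_delta_ball n0 delta0 cT Tt0).
Qed.

Lemma opnorm_beta_le t : Theta t -> opnorm ('J beta t) <= Lbeta_lip.
Proof.
have [t0 [r [r0 ballT]]] := ball_Theta.
apply: (opnorm_jacobian_le cT r0 ballT _ Lbeta_lip0 Lbeta_sm0) => //.
  exact: cst_beta_lip C.
exact: cst_beta_sm C.
Qed.

Lemma mean_score_jacobian b t : B b -> Theta t -> mean_score b *m ('J beta t)^T = 0.
Proof.
move=> Bb Tt; have [t0 [r [r0 ballT]]] := ball_Theta.
apply: (mul_jacobian_eq0 cT r0 ballT _ _ Tt) => // t1 t2 T1 T2.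
have -> : beta t1 - beta t2 = (beta t1 - b) - (beta t2 - b) by rewrite opprB addrA subrK.
by rewrite dotvBr !dotv_mean_score ?subrr//; exact: bB.
Qed.

Lemma perf_grad2_lip t t' : Theta t -> Theta t' ->
  enorm (perf_grad2 beta ell D p t - perf_grad2 beta ell D p t') <=
  (Lbeta_sm * Num.sqrt (Mell * Imax) +
   Lbeta_lip * (LG_beta * Lbeta_lip + LG_theta)) * enorm (t - t').
Proof.
move=> Tt Tt'; have Bt := bB Tt; have Bt' := bB Tt'.
set G := Gvec ell D p t (beta t); set G' := Gvec ell D p t' (beta t').
(* The mean loss is the multiple of the mean score to subtract for the variance bound to apply. The
   term with the difference of Jacobians then gives Lbeta_sm sqrt(Mell Imax), and the one with G -
   G' the last term of the constant. *)
pose c := Expect (D (beta t)) (fun z => ell z t).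
have -> : perf_grad2 beta ell D p t - perf_grad2 beta ell D p t' =
    (G - c *: mean_score (beta t)) *m ('J beta t - 'J beta t')^T +
    (G - G') *m ('J beta t')^T.
  by apply: mulmx_trB_centered; exact: mean_score_jacobian.
apply: le_trans (ler_enormD _ _) _; rewrite mulrDl; apply: lerD.
  apply: le_trans (enorm_mulmx_tr _ _) _; rewrite mulrAC; apply: ler_pM.
  - exact: opnorm_ge0.
  - exact: enorm_ge0.
  - exact: (cst_beta_sm C).
  - exact: enorm_centered_Gvec_le.
apply: le_trans (enorm_mulmx_tr _ _) _; rewrite -mulrA; apply: ler_pM.
- exact: opnorm_ge0.
- exact: enorm_ge0.
- exact: opnorm_beta_le.
apply: le_trans (cst_G C Tt Tt' Bt Bt') _; rewrite mulrDl lerD2r -mulrA.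
apply: ler_wpM2l; last exact: (cst_beta_lip C).
by case: (cst_ge0 C) => _ [].
Qed.

Lemma perf_grad_lip t t' : Theta t -> Theta t' ->
  enorm (perf_grad beta ell D p t - perf_grad beta ell D p t')
    <= (Lell_sm + Lell_lip * Lbeta_lip * Num.sqrt Imax
        + Lbeta_sm * Num.sqrt (Mell * Imax)
        + Lbeta_lip * (LG_beta * Lbeta_lip + LG_theta)) * enorm (t - t').
Proof.
move=> Tt Tt'; rewrite /perf_grad opprD addrACA.
apply: le_trans (ler_enormD _ _) _; rewrite -addrA mulrDl.
by apply: lerD; [exact: perf_grad1_lip|exact: perf_grad2_lip].
Qed.

(** * Differentiability of the performative loss *)

Lemma loss_increment_le z t y (K : R) : Theta t -> Theta y ->
  (forall u, Theta u -> enorm (grad (ell z) u) <= K) ->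
  `|ell z y - ell z t| <= K * enorm (y - t).
Proof.
move=> Tt Ty HK; rewrite -[y in ell z y](subrK t) [_ + t]addrC.
have [s s01|c c01 ->] := @MVT_line01 _ _ (ell z) t (y - t).
  exact/diff_derivable/(differentiable_loss (reg_ell A)).
rewrite -dotv_grad; last exact: (differentiable_loss (reg_ell A)).
apply: le_trans (CauchySchwarz_dotv _ _) _.
by rewrite ler_wpM2r ?enorm_ge0// HK//; exact: convex_set_segment.
Qed.

Lemma loss_taylor_le z t y (K : R) : Theta t -> Theta y ->
  (forall u, Theta u -> opnorm (hessian (ell z) u) <= K) ->
  `|ell z y - ell z t - dotv (grad (ell z) t) (y - t)| <= K * enorm (y - t) ^+ 2.
Proof.
move=> Tt Ty HK; rewrite -[y in ell z y](subrK t) [_ + t]addrC.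
apply: taylor2 => s s01; split.
- exact: (differentiable_loss (reg_ell A)).
- exact: (differentiable_grad_loss (reg_ell A)).
- by apply: HK; exact: convex_set_segment.
Qed.

(** Both factors are of order |y - t|: [densityB_le] is applied to the loss increment, whose L2 norm
    under every law is linear in |y - t| by the growth of the loss gradient, and [beta] is
    Lipschitz. *)
Lemma cross_increment_le : exists2 K : R, 0 <= K & forall t y, Theta t -> Theta y ->
  `|\int[mu]_z ((ell z y - ell z t) * (p z (beta y) - p z (beta t)))| <=
  K * enorm (y - t) ^+ 2.
Proof.
have [M HM] := reg_moments A; have [K4 K40 HK4] := reg_ell1 A.
set S := Num.sqrt (2 * (1 + `|M (2 * q4)%N|)).
have S0 : 0 <= S by exact: sqrtr_ge0.
exists (K4 * S * Num.sqrt Imax * Lbeta_lip) => [|t y Tt Ty].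
  by rewrite !mulr_ge0 ?sqrtr_ge0.
have mf : measurable_fun setT (fun z => `|ell z y - ell z t|).
  by apply: measurableT_comp => //; exact: measurable_funB.
have mpB : measurable_fun setT (fun z => p z (beta y) - p z (beta t)).
  by apply: measurable_funB; apply: (density_measurable Dp); exact: bB.
apply: (@le_trans _ _ (K4 * enorm (y - t) * S * Num.sqrt Imax * enorm (beta y - beta t))).
  apply: normr_Rintegral_le; first by apply: measurable_funM => //; exact: measurable_funB.
  under eq_integral do rewrite normrM.
  apply: densityB_le => //; last 3 first.
  - move=> c Bc; apply: (poly_growth_integral_sqr_le Dp HM (q := q4) Bc) => //.
    + by apply: le_q_max; rewrite !inE eqxx ?orbT.
    + by rewrite mulr_ge0 ?enorm_ge0.
    + move=> z zp; rewrite normr_id mulrAC; apply: loss_increment_le => // u Tu.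
      by apply: HK4 => //; exact: posset_sub Dp _ _ Bc zp.
  - exact: bB.
  - exact: bB.
  - by rewrite !mulr_ge0 ?enorm_ge0.
apply: (@le_trans _ _ (K4 * enorm (y - t) * S * Num.sqrt Imax *
    (Lbeta_lip * enorm (y - t)))).
  apply: ler_wpM2l; last exact: (cst_beta_lip C).
  by rewrite !mulr_ge0 ?enorm_ge0 ?sqrtr_ge0.
by rewrite le_eqVlt; apply/orP; left; apply/eqP; ring.
Qed.

Lemma mean_taylor_le : exists2 K : R, 0 <= K & forall t y, Theta t -> Theta y ->
  `|\int[D (beta t)]_z (ell z y - ell z t - dotv (grad (ell z) t) (y - t))| <=
  K * enorm (y - t) ^+ 2.
Proof.
have [M HM] := reg_moments A; have [K5 K50 HK5] := reg_ell2 A.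
exists (K5 * (1 + `|M q5|)) => [|t y Tt Ty]; first by rewrite mulr_ge0// addr_ge0.
have mf : measurable_fun setT
    (fun z => ell z y - ell z t - dotv (grad (ell z) t) (y - t)).
  apply: measurable_funB; first exact: measurable_funB.
  by apply: measurable_fun_dotv => j; [exact: mgrad|exact: measurable_cst].
apply: normr_Rintegral_le => //; rewrite mulrAC.
apply: (poly_growth_integral_le Dp HM (bB Tt)) => //.
- by apply: le_q_max; rewrite !inE eqxx ?orbT.
- by rewrite mulr_ge0 ?sqr_ge0.
move=> z zp; rewrite mulrAC; apply: loss_taylor_le => // u Tu.
by apply: HK5 => //; exact: posset_sub Dp _ _ (bB Tt) zp.
Qed.

(** Differentiation under the integral of [ell] times [p] with the argument of the loss frozen: the
    gradient of the integrand is [ell] times the score times [p]. *)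
Lemma has_grad_mean_loss t : Theta t ->
  has_grad_within B (fun b => Expect (D b) (fun z => ell z t)) (beta t)
    (Gvec ell D p t (beta t)).
Proof.
move=> Tt e e0; have Bt := bB Tt; have [_ _ H] := reg_int_ell A Tt Bt.
have E b : B b -> \int[mu]_(z in posset p (beta t)) (ell z t * p z b) =
    Expect (D b) (fun z => ell z t).
  move=> Bb; rewrite ExpectE (Rintegral_family Dp Bb (mell t) (integrable_loss Tt Bb)).
  apply: (Rintegral_posset mu Bt) => // z.
  by rewrite (reg_support A Bt Bb) => zp; rewrite (posset_out Dp Bb zp) mulr0.
have G : \row_j (\int[mu]_(z in posset p (beta t))
    grad (fun b => ell z t * p z b) (beta t) 0 j) = Gvec ell D p t (beta t).
  apply/rowP => j; rewrite !mxE ExpectE.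
  have mes : measurable_fun setT (fun z => ell z t * score p z (beta t) 0 j).
    by apply: measurable_funM => //; exact: mscore.
  rewrite (Rintegral_family Dp Bt mes (integrable_loss_score j Tt Bt)).
  apply: (Rintegral_posset mu Bt) => z zp; last by rewrite (posset_out Dp Bt zp) mulr0.
  have dp := differentiable_density Dp (reg_p A) Bt zp.
  rewrite mxE -[(fun b => _)]/(ell z t \*: p z) deriveZ; last exact: diff_derivable.
  rewrite (derive_density Dp (reg_p A) _ Bt zp) dotv_delta.
  by rewrite -[_ *: _]/(_ * _) mulrCA mulrC mulrAC.
rewrite G in H.
apply: (@filterS _ (nbhs (beta t)) _ _ _ _ (H e e0)) => b Hb Bb.
by move: (Hb Bb); rewrite !E.
Qed.

(** An exact splitting of the remainder: the cross term of both increments, the Taylor remainder of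
    the loss, that of the mean loss in the distribution parameter, and the linearization error of
    [beta] paired with G. The first two are O(|y - t|^2), the last two o(|y - t|). *)
Lemma perf_loss_increment t y : Theta t -> Theta y ->
  let G := Gvec ell D p t (beta t) in
  perf_loss beta ell D y - perf_loss beta ell D t -
    dotv (perf_grad beta ell D p t) (y - t) =
  \int[mu]_z ((ell z y - ell z t) * (p z (beta y) - p z (beta t))) +
  \int[D (beta t)]_z (ell z y - ell z t - dotv (grad (ell z) t) (y - t)) +
  (Expect (D (beta y)) (fun z => ell z t) - Expect (D (beta t)) (fun z => ell z t) -
    dotv G (beta y - beta t)) +
  dotv G (beta y - beta t - (y - t) *m 'J beta t).
Proof.
move=> Tt Ty G; have Bt := bB Tt; have By := bB Ty.
have iyy := integrable_loss Ty By; have iyt := integrable_loss Ty Bt.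
have ity := integrable_loss Tt By; have itt := integrable_loss Tt Bt.
have -> : \int[mu]_z ((ell z y - ell z t) * (p z (beta y) - p z (beta t))) =
    Expect (D (beta y)) (fun z => ell z y) - Expect (D (beta y)) (fun z => ell z t)
    - (Expect (D (beta t)) (fun z => ell z y) - Expect (D (beta t)) (fun z => ell z t)).
  have mB : measurable_fun setT (fun z => ell z y - ell z t) by exact: measurable_funB.
  have iBy : (D (beta y)).-integrable setT (EFin \o (fun z => ell z y - ell z t)).
    exact: (integrableB measurableT iyy ity).
  have iBt : (D (beta t)).-integrable setT (EFin \o (fun z => ell z y - ell z t)).
    exact: (integrableB measurableT iyt itt).
  rewrite !ExpectE -!RintegralB//.
  rewrite (Rintegral_family Dp By mB iBy) (Rintegral_family Dp Bt mB iBt).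
  rewrite -RintegralB//.
  - by apply: eq_Rintegral => z _; rewrite mulrBr.
  - exact: (iffLR (integrable_family Dp By mB) iBy).
  - exact: (iffLR (integrable_family Dp Bt mB) iBt).
have ig : forall j, (D (beta t)).-integrable setT (fun z => (grad (ell z) t 0 j)%:E).
  by move=> j; exact: integrable_grad_loss.
rewrite RintegralB//; last 2 first.
- exact: (integrableB measurableT iyt itt).
- exact: integrable_dotv.
rewrite RintegralB// Rintegral_dotv//.
have -> : \row_j \int[D (beta t)]_z grad (ell z) t 0 j = perf_grad1 beta ell D t.
  by apply/rowP => j; rewrite [RHS]mxE [LHS]mxE ExpectE.
rewrite /perf_loss -!ExpectE /perf_grad dotvDl /perf_grad2 dotv_mulmx -/G.
rewrite [dotv G (_ - _ - _)]dotvBr; ring.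
Qed.

Lemma perf_loss_has_grad t : Theta t ->
  has_grad_within Theta (perf_loss beta ell D) t (perf_grad beta ell D p t).
Proof.
move=> Tt e e0; have [K K0 HK] := cross_increment_le.
have [K' K'0 HK'] := mean_taylor_le.
set G := Gvec ell D p t (beta t).
(* Shares of e: a quarter for the mean loss, a quarter for the linearization of [beta], and half for
   the two quadratic terms once |y - t| is small. *)
have e1 : 0 < e / (4 * (Lbeta_lip + 1)) by rewrite divr_gt0 ?mulr_gt0 ?ltr_wpDl.
have e2 : 0 < e / (4 * (enorm G + 1)) by rewrite divr_gt0 ?mulr_gt0 ?ltr_wpDl ?enorm_ge0.
have e3 : 0 < e / (2 * (K + K' + 1)) by rewrite divr_gt0 ?mulr_gt0 ?ltr_wpDl ?addr_ge0.
have H1 : \forall y \near t, B (beta y) ->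
    `|Expect (D (beta y)) (fun z => ell z t) - Expect (D (beta t)) (fun z => ell z t) -
      dotv G (beta y - beta t)| <=
    e / (4 * (Lbeta_lip + 1)) * enorm (beta y - beta t).
  (* The expansion holds near [beta t]; continuity of [beta] pulls it back to a neighborhood of
     [t]. *)
  exact: differentiable_continuous (dbeta t) _ (has_grad_mean_loss Tt e1).
have H2 := differentiable_taylor1 (dbeta t) e2.
have H3 : \forall y \near t, enorm (y - t) <= e / (2 * (K + K' + 1)).
  have k0 : 0 < n.+1%:R :> R by [].
  apply/nbhs_normP; exists (e / (2 * (K + K' + 1)) / n.+1%:R) => /=.
    by rewrite divr_gt0.
  move=> y /=; rewrite ltr_pdivlMr// => /ltW ty; rewrite enormBC.
  apply: le_trans (enorm_le_norm _) _; apply: le_trans _ ty.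
  by rewrite mulrC ler_wpM2l// ler_nat.
apply: (@filterS _ (nbhs t) _ _ _ _ (filterI H1 (filterI H2 H3))) => y [{}H1 [{}H2 {}H3]] Ty.
rewrite perf_loss_increment//= -/G.
set s := enorm (y - t) in H2 H3 *; have s0 : 0 <= s by exact: enorm_ge0.
apply: le_trans (ler_normD _ _) _.
apply: le_trans (lerD (ler_normD _ _) (lexx _)) _.
apply: le_trans (lerD (lerD (ler_normD _ _) (lexx _)) (lexx _)) _.
have HA := HK _ _ Tt Ty; have HB := HK' _ _ Tt Ty; rewrite -/s in HA HB.
have HC := H1 (bB Ty).
have HD := CauchySchwarz_dotv G (beta y - beta t - (y - t) *m 'J beta t).
have Hb := cst_beta_lip C Ty Tt; rewrite -/s in Hb.
have HC' : e / (4 * (Lbeta_lip + 1)) * enorm (beta y - beta t) <= e / 4 * s.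
  apply: le_trans (ler_wpM2l (ltW e1) Hb) _.
  by rewrite mulrA ler_wpM2r// mulrC ler_frac_addr1// ltW.
have HD' : enorm G * (e / (4 * (enorm G + 1)) * s) <= e / 4 * s.
  by rewrite mulrA ler_wpM2r// ler_frac_addr1 ?enorm_ge0// ltW.
have HAB : (K + K') * s ^+ 2 <= e / 2 * s.
  rewrite expr2 mulrA; apply: ler_wpM2r => //.
  have KK : 0 <= K + K' by exact: addr_ge0.
  by apply: (le_trans (ler_wpM2l KK H3)); rewrite ler_frac_addr1// ltW.
have HD2 := le_trans HD (ler_wpM2l (enorm_ge0 G) H2).
have HC2 := le_trans HC HC'; have HD3 := le_trans HD2 HD'.
rewrite -/G in HC2.
apply: le_trans (lerD (lerD (lerD HA HB) HC2) HD3) _.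
rewrite -mulrDl; apply: le_trans (lerD (lerD HAB (lexx _)) (lexx _)) _; lra.
Qed.

End performative_loss.

(** The first conjunct certifies that [perf_grad] is indeed a gradient of the performative loss,
    relative to [Theta]; the second is the Lipschitz bound on it. *)
Theorem proposition2 (R : realType) (n m d : nat)
    (n_gt0 : (0 < n)%N) (m_gt0 : (0 < m)%N) (d_gt0 : (0 < d)%N)
    (Theta : set 'rV[R]_n) (delta : R) (delta_gt0 : 0 < delta)
    (B : set 'rV[R]_m) (beta : 'rV[R]_n -> 'rV[R]_m)
    (Z : set (Rvec R d)) (ell : Rvec R d -> 'rV[R]_n -> R)
    (mu : {sigma_finite_measure set (Rvec R d) -> \bar R})
    (D : 'rV[R]_m -> probability (Rvec R d) R)
    (p : Rvec R d -> 'rV[R]_m -> R)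
    (Pred : forall k, k.-tuple (Rvec R d) -> 'rV[R]_m)
    (q1 q2 q3 q4 q5 : nat)
    (Lell_lip Lell_sm Lbeta_lip Lbeta_sm LG_beta LG_theta Mell Imax : R)
    (Dp : density_family mu Z B D p)
    (A : regularity Theta delta B beta Z ell mu D p Pred q1 q2 q3 q4 q5)
    (C : smoothness_constants Theta B beta ell D p
           Lell_lip Lell_sm Lbeta_lip Lbeta_sm LG_beta LG_theta Mell Imax) :
  (forall t, Theta t ->
     has_grad_within Theta (perf_loss beta ell D) t (perf_grad beta ell D p t))
  /\
  (forall t t', Theta t -> Theta t' ->
     enorm (perf_grad beta ell D p t - perf_grad beta ell D p t')
       <= (Lell_sm + Lell_lip * Lbeta_lip * Num.sqrt Imax
           + Lbeta_sm * Num.sqrt (Mell * Imax)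
           + Lbeta_lip * (LG_beta * Lbeta_lip + LG_theta)) * enorm (t - t')).
Proof.
split=> [t Tt|t t' Tt Tt'].
  exact: (perf_loss_has_grad Dp A C).
exact: (perf_grad_lip n_gt0 delta_gt0 Dp A C).
Qed.
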